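(* Let $N\ge2$ and let $b(t)$ be the Brownian motion on the spider graph $Sp_N$ with Kirchhoff gluing at the origin, started at the origin. For $L>0$ let $\tau_{L,1}=\min\{t: b(t)\text{ is the point }x_1=L\text{ on leg }l_1\}$ (no condition on the motion along the other legs). Then for every $\lambda>0$, $u(\lambda,L):=E_0e^{-\lambda\tau_{L,1}}$ satisfies $$u(\lambda,L)=\frac{2}{N}e^{-\sqrt{2\lambda}L}+\frac{2}{N}\Big(1-\frac{2}{N}\Big)e^{-3\sqrt{2\lambda}L}+\frac{2}{N}\Big(1-\frac{2}{N}\Big)^2e^{-5\sqrt{2\lambda}L}+\cdots=\sum_{n=0}^\infty\frac{2}{N}\Big(1-\frac{2}{N}\Big)^ne^{-(2n+1)\sqrt{2\lambda}L}.$$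
   Context: The spider graph $Sp_N$ consists of $N$ half-lines (legs) $l_1,\dots,l_N$, each a copy of $[0,\infty)$ with coordinate $x_i\ge0$, glued at their common endpoint $0$. The Brownian motion $b(t)$ on $Sp_N$ is the continuous strong Markov process with generator $\frac12\frac{d^2}{dx_i^2}$ on each leg, acting on functions continuous on $Sp_N$, twice differentiable on each leg, and satisfying Kirchhoff's condition $\sum_{i=1}^N f_i'(0)=0$ ($f_i'(0)$ the one-sided derivative at $0$ along leg $l_i$). Equivalently, away from $0$ it is a standard one-dimensional Brownian motion along the leg and from $0$ it enters each leg with equal probability $1/N$. *)

(* Defs.v *)
From HB Require Import structures.
From mathcomp Require Import all_boot all_order all_algebra.
From mathcomp Require Import all_classical all_reals all_analysis.
Set Implicit Arguments. Unset Strict Implicit. Unset Printing Implicit Defensive.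
Import Order.TTheory GRing.Theory Num.Theory.
Import numFieldNormedType.Exports.
Local Open Scope classical_set_scope.
Local Open Scope ring_scope.

Section Spider.
Variables (R : realType) (N : nat).

(* A point of Sp_N is represented by (i, x) with i : 'I_N the leg and x >= 0
   the coordinate on that leg; all points (i, 0) represent the vertex 0.
   Every object below is insensitive to the leg label when x = 0. *)
Definition spider_pt := ('I_N * R)%type.

Definition spider_dist (p q : spider_pt) : R :=
  if p.1 == q.1 then `|p.2 - q.2| else p.2 + q.2.

Definition spider_fun := 'I_N -> R -> R.
Definition ev (f : spider_fun) (p : spider_pt) : R := f p.1 p.2.

Definition spider_test (g : spider_fun) : Prop :=
  (forall i j, g i 0 = g j 0) /\ (forall i, continuous (g i)) /\
  (exists M : R, forall i x, 0 <= x -> `|g i x| <= M).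

Definition d2 (f : spider_fun) : spider_fun := fun i => derive1 (derive1 (f i)).

(* domain of the generator (1/2) d^2/dx_i^2 with Kirchhoff gluing:
   continuous on Sp_N, C^2 on each leg (up to the vertex), bounded with
   bounded second derivative, L f continuous at the vertex, and
   Kirchhoff's condition sum_i f_i'(0) = 0. *)
Definition gen_dom (f : spider_fun) : Prop :=
  (forall i j, f i 0 = f j 0) /\
  (forall i x, derivable (f i) x 1) /\
  (forall i x, derivable (derive1 (f i)) x 1) /\
  (forall i, continuous (d2 f i)) /\
  (exists M : R, forall i x, 0 <= x -> `|f i x| <= M /\ `|d2 f i x| <= M) /\
  (forall i j, d2 f i 0 = d2 f j 0) /\
  (\sum_(i < N) derive1 (f i) 0 = 0).

(* Brownian motion on Sp_N with Kirchhoff gluing started at 0, as the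
   continuous solution of the martingale problem for the generator *)
Definition spider_BM {d} {Omega : measurableType d}
  (P : probability Omega R) (b : R -> Omega -> spider_pt) : Prop :=
  (forall t w, 0 <= (b t w).2) /\
  (forall t (i : 'I_N), measurable_fun setT
      (fun w => if (b t w).1 == i then (b t w).2 else 0)) /\
  (forall w, (b 0 w).2 = 0) /\
  (forall w t, 0 <= t -> forall e : R, 0 < e -> exists2 de : R, 0 < de &
     forall s, 0 <= s -> `|s - t| < de -> spider_dist (b s w) (b t w) < e) /\
  (* martingale problem: for f in the generator domain,
     M_t = f(b_t) - int_0^t (1/2) f''(b_u) du is a martingale
     w.r.t. the natural filtration of b *)
  (forall f, gen_dom f -> forall s t, 0 <= s -> s <= t ->
     forall gr : seq (spider_fun * R),
       (forall p, p \in gr -> spider_test p.1 /\ 0 <= p.2 <= s) ->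
       let M := fun (t : R) (w : Omega) =>
         ev f (b t w) -
         Rintegral lebesgue_measure `[0, t] (fun u => 2^-1 * ev (d2 f) (b u w)) in
       Rintegral P setT
         (fun w => (M t w - M s w) * \prod_(p <- gr) ev p.1 (b p.2 w)) = 0).

(* exp(-lambda * tau_{L,1}) along a path, with exp(-lambda*oo) = 0;
   leg l_1 is the leg with index 0 *)
Definition hit_lap (lam L : R) (path : R -> spider_pt) : R :=
  let H := [set t | 0 <= t /\ nat_of_ord (path t).1 = 0%N /\ (path t).2 = L] in
  if pselect (H !=set0) then expR (- (lam * inf H)) else 0.

End Spider.

(* Main.v *)
(* Let gam = sqrt(2 lam), r = 1 - 2/N and phi x = e^(gam x) - r e^(-gam x). The
   function f equal to phi on leg l_1 and to (1 - r) e^(-gam x) on the other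
   legs solves f''/2 = lam f, is continuous at the vertex and satisfies
   Kirchhoff's condition, so e^(-lam t) f(b t) should be a martingale up to the
   hitting time tau of L; optional stopping then gives
   phi(L) E e^(-lam tau) = f(0) = 2/N, and expanding 1/phi(L) as a geometric
   series yields the formula.

   Optional stopping is carried out on the grid of mesh T/n. Beyond a level
   l, f is modified into a bounded C^2 function, so that it enters the domain of
   the generator. The discrete discount (1 + lam h)^(-k) makes the Abel
   summation of the martingale increments exact, and the indicator of "not above
   lev so far" is the limit of the products of continuous test functions allowed
   by the martingale problem. Stopping at the first grid time above lev, with
   lev < l, uniform continuity keeps the path below l, where f''/2 = lam f, once
   the mesh is small. The choice lev < l = L bounds E e^(-lam tau) from above,
   the choice L = lev < l bounds it from below, and both bounds tend to the same
   value as T tends to infinity and lev (resp. l) to L. *)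
Require Import Defs.
From HB Require Import structures.
From mathcomp Require Import all_boot all_order all_algebra.
From mathcomp Require Import all_classical all_reals all_analysis.
From mathcomp Require Import measurable_realfun lra ring.
Import Order.TTheory GRing.Theory Num.Theory.
Import numFieldNormedType.Exports.
Local Open Scope classical_set_scope.
Local Open Scope ring_scope.

(** * Uniform continuity, Riemann sums and gluing of functions on the real line *)

Section RealAnalysis.
Context {R : realType}.
Implicit Types (g G : R -> R) (a b e : R).

Lemma continuous_epsP g :
  continuous g <-> (forall t e, 0 < e -> exists2 de, 0 < de &
    forall s, `|t - s| < de -> `|g t - g s| < e).
Proof.
split=> [cg t e e0|H t].
  by have /cvgrPdist_lt /(_ e e0) /nbhs_ballP[de /= de0 H] := cg t; exists de.
apply/cvgrPdist_lt => e e0; have [de de0 Hde] := H t e e0.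
by apply/nbhs_ballP; exists de.
Qed.

(** Heine-Cantor through the near-covering form of compactness: around each point, half of its
    modulus of continuity is spent on moving the centre and the other half on the distance to
    [v]. *)
Lemma uniformly_continuous_segment g a b e : continuous g -> 0 < e ->
  exists2 de, 0 < de & forall u v, a <= u <= b -> `|u - v| < de ->
    `|g u - g v| < e.
Proof.
move=> /continuous_epsP cg e0.
have /compact_near_coveringP := @segment_compact R a b.
move=> /(_ R 0^'+ (fun de u => forall v, `|u - v| < de -> `|g u - g v| < e) _).
case=> [u _|de /= de0 H].
  have [de de0 Hde] := cg u _ (divr_gt0 e0 (ltr0n _ 2)).
  have d20 : 0 < de / 2 by rewrite divr_gt0.
  exists (ball u (de / 2), [set x : R | x < de / 2]) => /=.
    by split; [exact: nbhsx_ballx|exact: nbhs_right_lt].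
  move=> [x d] /= [ux dd] v xv; rewrite (splitr e).
  have -> : g x - g v = (g u - g v) - (g u - g x) by ring.
  apply: (le_lt_trans (ler_normB _ _)); apply: ltrD; apply: Hde.
    have -> : u - v = (u - x) + (x - v) by ring.
    rewrite (splitr de) (le_lt_trans (ler_normD _ _))// ltrD//.
    exact: lt_trans xv dd.
  by rewrite (lt_trans ux)// ltr_pdivrMr// ltr_pMr// ltr1n.
exists (de / 2); first by rewrite divr_gt0.
move=> u v uab uv.
have d20 : 0 < de / 2 by rewrite divr_gt0.
have dd : `|0 - de / 2| < de.
  by rewrite sub0r normrN gtr0_norm// ltr_pdivrMr// ltr_pMr// ltr1n.
by apply: (H (de / 2) dd d20 u) => //=; rewrite in_itv.
Qed.

Lemma integral_near_cst G a b e : continuous G -> a <= b ->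
  (forall u, a <= u <= b -> `|G u - G a| <= e) ->
  `|\int[lebesgue_measure]_(u in `[a, b]) G u - (b - a) * G a| <= e * (b - a).
Proof.
move=> cG ab H.
have iG h : continuous h -> lebesgue_measure.-integrable `[a, b] (EFin \o h).
  move=> ch; apply: continuous_compact_integrable; first exact: segment_compact.
  exact: continuous_subspaceT.
have mab : fine (lebesgue_measure `[a, b]%classic) = b - a :> R.
  rewrite lebesgue_measure_itv /= lte_fin; case: ltP => //= ba.
  by have := le_anti (introT andP (conj ab ba)) => ->; rewrite subrr.
have -> : (b - a) * G a = \int[lebesgue_measure]_(u in `[a, b]) (cst (G a) u).
  by rewrite Rintegral_cst// mab mulrC.
rewrite -RintegralB//; [|exact: iG|by apply: iG; exact: cst_continuous].
apply: (le_trans (le_normr_Rintegral _ _)) => //.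
  apply: iG => u; apply: cvgB; [exact: cG|exact: cvg_cst].
rewrite -mab -Rintegral_cst//; apply: le_Rintegral => //.
- apply: iG => u; apply: cvg_norm; apply: cvgB; [exact: cG|exact: cvg_cst].
- by apply: (iG (cst e)); exact: cst_continuous.
Qed.

Lemma integral_segmentB G a b : continuous G -> 0 <= a -> a <= b ->
  \int[lebesgue_measure]_(u in `[0, b]) G u -
  \int[lebesgue_measure]_(u in `[0, a]) G u =
  \int[lebesgue_measure]_(u in `[a, b]) G u.
Proof.
move=> cG a0 ab.
have iG c e: lebesgue_measure.-integrable `[c, e] (EFin \o G).
  apply: continuous_compact_integrable; first exact: segment_compact.
  exact: continuous_subspaceT.
rewrite Rintegral_itvB//.
by apply: Rintegral_itv_obnd_cbnd; apply: integrableS (iG a b) => //;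
  apply: subset_itvr; rewrite bnd_simp.
Qed.

Lemma integral_increment G a b e : continuous G -> 0 <= a -> a <= b ->
  (forall u, a <= u <= b -> `|G u - G a| <= e) ->
  `|\int[lebesgue_measure]_(u in `[0, b]) G u -
    \int[lebesgue_measure]_(u in `[0, a]) G u - (b - a) * G a| <= e * (b - a).
Proof. by move=> cG a0 ab H; rewrite integral_segmentB// integral_near_cst. Qed.

Lemma near_mesh_lt (t e : R) : 0 < e -> \forall n \near \oo, t / n%:R < e.
Proof.
move=> e0; near=> n.
have n0 : (0 < n%:R :> R) by rewrite ltr0n; near: n; exists 1%N.
rewrite ltr_pdivrMr// mulrC -ltr_pdivrMr//.
by near: n; exact: nbhs_infty_gtr.
Unshelve. all: by end_near. Qed.

Lemma near_invS_lt (e : R) : 0 < e -> \forall n \near \oo, n.+1%:R^-1 < e.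
Proof.
move=> e0; near=> n; rewrite -div1r ltr_pdivrMr// mulrC -ltr_pdivrMr//.
have : (e^-1 < n%:R) by near: n; exact: nbhs_infty_gtr.
by rewrite div1r => /lt_trans; apply; rewrite ltr_nat.
Unshelve. all: by end_near. Qed.

(** The primitive [J] telescopes over the mesh, and on each cell it differs from the rectangle by at
    most the oscillation of [G] times [h]. This is what makes the drift a limit of finite sums of
    measurable functions. *)
Lemma cvg_riemann_sum G t : continuous G -> 0 <= t ->
  (fun n => \sum_(j < n) (t / n%:R * G (j%:R * (t / n%:R)))) @ \oo -->
  \int[lebesgue_measure]_(u in `[0, t]) G u.
Proof.
move=> cG t0; apply/cvgrPdist_le => e e0.
(* Dividing by [t + 1] rather than [t] also covers [t = 0]; the total error is [e * t / (t + 1)]. *)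
have t1 : 0 < t + 1 by rewrite ltr_wpDl.
have e1 : 0 < e / (t + 1) by rewrite divr_gt0.
have [de de0 Hde] := uniformly_continuous_segment G 0 t _ cG e1.
near=> n.
have n0 : (0 < n)%N by near: n; exists 1%N.
set h := t / n%:R.
have hde : h < de by rewrite /h; near: n; exact: near_mesh_lt.
have h0 : 0 <= h by rewrite divr_ge0.
have nh : n%:R * h = t by rewrite /h mulrCA divff ?mulr1// pnatr_eq0 -lt0n.
pose J u := \int[lebesgue_measure]_(u in `[0, u]) G u.
rewrite -[X in X - _]/(J t).
have -> : J t = \sum_(j < n) (J (j.+1%:R * h) - J (j%:R * h)).
  rewrite -(big_mkord xpredT (fun j => J (j.+1%:R * h) - J (j%:R * h))).
  rewrite (telescope_sumr (fun j => J (j%:R * h)))// nh mul0r.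
  by rewrite /J set_itv1 Rintegral_set1 subr0.
rewrite -sumrB (le_trans (ler_norm_sum _ _ _))//.
apply: (@le_trans _ _ (\sum_(j < n) (e / (t + 1) * h))).
  apply: ler_sum => j _.
  have jS : j.+1%:R * h - j%:R * h = h by rewrite -mulrBl -natrB// subSnn mul1r.
  rewrite -[X in _ - X * G _]jS -[X in _ <= _ * X]jS.
  apply: integral_increment => //; first by rewrite mulr_ge0.
    by rewrite ler_wpM2r// ler_nat.
  move=> u /andP[ju uj]; rewrite distrC ltW//; apply: Hde.
    by rewrite mulr_ge0//= -nh ler_wpM2r// ler_nat ltnW.
  rewrite distrC ger0_norm ?subr_ge0// (le_lt_trans _ hde)//.
  by rewrite -[leRHS]jS lerB.
rewrite sumr_const card_ord -mulrnAr -(mulr_natl h) nh mulrAC ler_pdivrMr//.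
by rewrite ler_wpM2l ?lerDl// ltW.
Unshelve. all: by end_near. Qed.

Lemma continuous_glue_at (p q : R -> R) (l : R) :
  {for l, continuous p} -> {for l, continuous q} -> p l = q l ->
  {for l, continuous (fun x => if x <= l then p x else q x)}.
Proof.
move=> cp cq pq; apply/cvgrPdist_lt => e e0; rewrite lexx.
have /cvgrPdist_lt/(_ _ e0) Hp := cp; have /cvgrPdist_lt/(_ _ e0) Hq := cq.
near=> x; case: ifP => _; first by near: x.
by rewrite pq; near: x.
Unshelve. all: by end_near. Qed.

Lemma near_glue (p q : R -> R) (l x : R) : x != l ->
  \forall y \near x, (if x <= l then p else q) y = if y <= l then p y else q y.
Proof.
rewrite neq_lt => /orP[xl|lx]; near=> y.
  rewrite ltW//; have -> // : y <= l by rewrite ltW//; near: y; exact: lt_nbhsl.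
rewrite leNgt lx/=; have -> // : (y <= l) = false.
by apply/negbTE; rewrite -ltNge; near: y; exact: lt_nbhsr.
Unshelve. all: by end_near. Qed.

Lemma continuous_glue (p q : R -> R) (l : R) : continuous p -> continuous q ->
  p l = q l -> continuous (fun x => if x <= l then p x else q x).
Proof.
move=> cp cq pq x; have [->|xl] := eqVneq x l.
  exact: continuous_glue_at (cp l) (cq l) pq.
have H := near_glue p q l x xl.
rewrite /continuous_at -(nbhs_singleton H).
apply: (cvg_trans (near_eq_cvg H)); case: ifP => _; [exact: cp|exact: cq].
Qed.

(** At [l], Caratheodory's criterion reduces the claim to gluing the two slope functions, whose
    values [dp l] and [dq l] agree there. Elsewhere only one branch is seen near [x]. *)
Lemma is_derive_glue (p q dp dq : R -> R) (l : R) :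
  (forall x : R, is_derive x 1 p (dp x)) -> (forall x : R, is_derive x 1 q (dq x)) ->
  p l = q l -> dp l = dq l ->
  forall x : R, is_derive x 1 (fun x => if x <= l then p x else q x)
                       (if x <= l then dp x else dq x).
Proof.
move=> hp hq pq dpq x; have [->|xl] := eqVneq x l; last first.
  apply: (near_eq_is_derive (near_glue p q l x xl)).
  by case: ifP => _; [exact: hp|exact: hq].
rewrite lexx; apply/is_derive1_caratheodory.
have /is_derive1_caratheodory[gp [Ep cp gpl]] := hp l.
have /is_derive1_caratheodory[gq [Eq cq gql]] := hq l.
exists (fun x => if x <= l then gp x else gq x); split.
- by move=> z; rewrite lexx; case: ifP => _; rewrite ?Ep// pq Eq.
- by apply: continuous_glue_at => //; rewrite gpl gql.
- by rewrite lexx.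
Qed.

End RealAnalysis.

(** * Bounded convergence for a probability measure *)

Section BoundedConvergence.
Context {d} {Omega : measurableType d} {R : realType} (P : probability Omega R).
Implicit Types (X : nat -> Omega -> R) (Y Z : Omega -> R) (C : R).

Lemma bounded_measurable_integrable Y C : measurable_fun setT Y ->
  (forall w, `|Y w| <= C) -> P.-integrable setT (EFin \o Y).
Proof.
move=> mY bY; apply: measurable_bounded_integrable => //.
  by rewrite (le_lt_trans (probability_le1 P measurableT))// ltry.
by exists C; split => [|x Cx w _]; [exact: num_real|exact: (le_trans (bY w) (ltW Cx))].
Qed.

Lemma bounded_convergence X Y C : (forall n, measurable_fun setT (X n)) ->
  (forall n w, `|X n w| <= C) -> (forall w, X ^~ w @ \oo --> Y w) ->
  (fun n => \int[P]_w X n w) @ \oo --> \int[P]_w Y w.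
Proof.
move=> mX bX XY.
have mY : measurable_fun setT Y.
  exact: (measurable_fun_cvg mX (fun w _ => XY w)).
have bY w : `|Y w| <= C.
  apply: (ler_cvg_to (cvg_norm (XY w)) (cvg_cst C)).
  by apply: nearW => n; exact: bX.
have iC : P.-integrable setT (EFin \o cst C).
  by apply: (bounded_measurable_integrable _ `|C|) => //; exact: measurable_cst.
have XYE w : setT w -> (fun n => (X n w)%:E) @ \oo --> (EFin \o Y) w.
  by move=> _; apply: cvg_EFin; [exact: nearW|exact: XY].
have [_ _ H] := @dominated_convergence _ _ _ P setT measurableT
  (fun n w => (X n w)%:E) (EFin \o Y) (EFin \o cst C)
  (fun n => iffRL (measurable_EFinP _ _) (mX n))
  (iffRL (measurable_EFinP _ _) mY)
  (aeW _ XYE) iC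
  (aeW _ (fun w n _ => bX n w)).
apply: fine_cvg; rewrite fineK; first exact: H.
exact: integrable_fin_num (bounded_measurable_integrable _ _ mY bY).
Qed.

(** A Fatou-type argument: the truncation [V n] is bounded and tends to 0, while its integral is at
    most minus that of [Z]. The threshold in [n] may depend on [w], as it does for moduli of
    continuity of individual paths. *)
Lemma Rintegral_le0_liminf X Z C D : (forall n, measurable_fun setT (X n)) ->
  (forall n w, `|X n w| <= C) -> (forall n, \int[P]_w X n w = 0) ->
  measurable_fun setT Z -> (forall w, `|Z w| <= D) ->
  (forall w e, 0 < e -> \forall n \near \oo, Z w <= X n w + e) ->
  \int[P]_w Z w <= 0.
Proof.
move=> mX bX X0 mZ bZ H.
pose V n w := Num.min (X n w - Z w) 0.
have mXZ n : measurable_fun setT (fun w => X n w - Z w).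
  exact: measurable_funB.
have mV n : measurable_fun setT (V n) by exact: measurable_minr.
have bXZ n w : `|X n w - Z w| <= C + D.
  by rewrite (le_trans (ler_normB _ _))// lerD.
have bV n w : `|V n w| <= C + D.
  rewrite /V; case: (leP (X n w - Z w) 0) => _; first exact: bXZ.
  by rewrite normr0 (le_trans _ (bXZ n w)).
have V0 w : V ^~ w @ \oo --> (0 : R).
  apply/cvgrPdist_le => e e0; near=> n; rewrite sub0r normrN /V.
  have Ze : Z w <= X n w + e by near: n; exact: H w e e0.
  case: (leP (X n w - Z w) 0) => XZ; last by rewrite normr0 ltW.
  by rewrite ler0_norm// opprB lerBlDl.
have iV := bounded_convergence _ _ _ mV bV V0.
have iZ := bounded_measurable_integrable _ _ mZ bZ.
have E n : \int[P]_w V n w <= - \int[P]_w Z w.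
  rewrite -sub0r -(X0 n) -RintegralB//; last exact: bounded_measurable_integrable (bX n).
  apply: le_Rintegral => //.
  - exact: bounded_measurable_integrable (bV n).
  - exact: bounded_measurable_integrable (bXZ n).
  - by move=> w _; rewrite /V; case: (leP (X n w - Z w) 0) => // /ltW.
rewrite -oppr_ge0.
have -> : 0 = \int[P]_w 0 :> R by rewrite Rintegral_cst// mul0r.
by apply: (ler_cvg_to iV (cvg_cst _)); exact: nearW.
Unshelve. all: by end_near. Qed.

Definition centred (Y : Omega -> R) := [/\ measurable_fun setT Y,
  exists C : R, forall w, `|Y w| <= C & \int[P]_w Y w = 0].

End BoundedConvergence.

(** * Spider paths read through their leg coordinates *)

Section SpiderPaths.
Context {R : realType} {N : nat}.
Local Notation point := (spider_pt R N).
Implicit Types (i j : 'I_N) (p q : point) (f : spider_fun R N).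

Definition leg_coord i p : R := if p.1 == i then p.2 else 0.

(** Every term but that of the current leg vanishes. Continuity and measurability of [f] along a
    path are thereby reduced to those of the leg coordinates; the leg label itself may jump at the
    vertex. *)
Lemma ev_leg_coord f p i : (forall i j, f i 0 = f j 0) ->
  ev f p = f i 0 + \sum_(j < N) (f j (leg_coord j p) - f j 0).
Proof.
move=> f0; rewrite (bigD1 p.1)//= big1 => [|j jp].
  by rewrite /leg_coord eqxx addr0 (f0 i p.1) addrC subrK.
by rewrite /leg_coord eq_sym (negbTE jp) subrr.
Qed.

Lemma leg_coord_dist i p q : 0 <= p.2 -> 0 <= q.2 ->
  `|leg_coord i p - leg_coord i q| <= spider_dist p q.
Proof.
move=> p0 q0; rewrite /leg_coord /spider_dist.
have [pi|pi] := eqVneq p.1 i; have [qi|qi] := eqVneq q.1 i.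
- by rewrite pi qi eqxx.
- by rewrite pi eq_sym (negbTE qi) subr0 ger0_norm// lerDl.
- by rewrite qi (negbTE pi) sub0r normrN ger0_norm// lerDr.
- by rewrite subrr normr0; case: ifP => _; rewrite ?addr_ge0.
Qed.

Definition spider_path_continuous (b : R -> point) :=
  forall t, 0 <= t -> forall e, 0 < e -> exists2 de, 0 < de &
     forall s, 0 <= s -> `|s - t| < de -> spider_dist (b s) (b t) < e.

Variable b : R -> point.
Hypothesis b_ge0 : forall t, 0 <= (b t).2.
Hypothesis b_cont : spider_path_continuous b.

(* Paths are only continuous on [0, +oo[: precomposing with the absolute value
   gives functions continuous on the whole line. *)
Lemma continuous_leg_coord i : continuous (fun u : R => leg_coord i (b `|u|)).
Proof.
apply/continuous_epsP => t e e0; have [de de0 H] := b_cont `|t| (normr_ge0 t) e e0.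
exists de => // s ts; rewrite distrC.
apply: (le_lt_trans (leg_coord_dist _ _ _ _ _)) => //; apply: H => //.
by rewrite (le_lt_trans (ler_dist_dist _ _))// distrC.
Qed.

Lemma continuous_ev f : (forall i j, f i 0 = f j 0) ->
  (forall i, continuous (f i)) -> continuous (fun u : R => ev f (b `|u|)).
Proof.
move=> f0 cf; have i := (b 0).1.
have -> : (fun u : R => ev f (b `|u|)) = (fun u => f i 0 +
    \sum_(j < N) (f j (leg_coord j (b `|u|)) - f j 0)).
  by apply/funext => u; exact: ev_leg_coord.
move=> u; apply: cvgD; first exact: cvg_cst.
apply: cvg_big => [|j _]; first exact: add_continuous.
apply: cvgB; last exact: cvg_cst.
by apply: continuous_comp; [exact: continuous_leg_coord|exact: cf].
Qed.

End SpiderPaths.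

Lemma measurable_ev {R : realType} {N : nat} {d} {Omega : measurableType d}
    (X : Omega -> spider_pt R N) (f : spider_fun R N) (i : 'I_N) :
  (forall j, measurable_fun setT (fun w => leg_coord j (X w))) ->
  (forall i j, f i 0 = f j 0) -> (forall i, continuous (f i)) ->
  measurable_fun setT (fun w => ev f (X w)).
Proof.
move=> mX f0 cf.
have -> : (fun w => ev f (X w)) = (fun w => f i 0 +
    \sum_(j < N) (f j (leg_coord j (X w)) - f j 0)).
  by apply/funext => w; exact: ev_leg_coord.
apply: measurable_funD => //; apply: measurable_sum => j.
apply: measurable_funB => //.
apply: (measurableT_comp (f := f j)); last exact: mX.
exact: continuous_measurable_fun.
Qed.

(** * Bounded C^2 continuation of exponential solutions *)

Section ExitFunction.
Context {R : realType}.
Implicit Types (a b c g l x : R).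

Definition expR_comb g a b x := a * expR (g * x) + b * expR (- (g * x)).
(** Bounded on the whole line together with its derivatives, with three free coefficients: enough to
    match a value and two derivatives at [l]. *)
Definition trig_comb l a b c x := a * cos (x - l) + b * sin (x - l) + c.

Lemma is_derive_expR_comb g a b x :
  is_derive x 1 (expR_comb g a b) (expR_comb g (g * a) (- (g * b)) x).
Proof.
rewrite /expR_comb; apply: is_derive_eq.
rewrite -[g%:A]/(g * 1) -![_ *: _]/(_ * _); ring.
Qed.

Lemma is_derive_trig_comb l a b c x :
  is_derive x 1 (trig_comb l a b c) (trig_comb l b (- a) 0 x).
Proof.
rewrite /trig_comb; apply: is_derive_eq.
rewrite -![_ *: _]/(_ * _); ring.
Qed.

Lemma expR_comb_bound g a b l x : 0 <= g -> 0 <= x <= l ->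
  `|expR_comb g a b x| <= `|a| * expR (g * l) + `|b|.
Proof.
move=> g0 /andP[x0 xl]; rewrite (le_trans (ler_normD _ _))// !normrM.
rewrite !(ger0_norm (expR_ge0 _)) lerD//.
  by rewrite ler_wpM2l// ler_expR ler_wpM2l.
by rewrite ler_piMr// -expR0 ler_expR oppr_le0 mulr_ge0.
Qed.

Lemma trig_comb_bound l a b c x : `|trig_comb l a b c x| <= `|a| + `|b| + `|c|.
Proof.
rewrite (le_trans (ler_normD _ _))// lerD2r (le_trans (ler_normD _ _))//.
by rewrite !normrM lerD// ler_piMr// ?cos_max ?sin_max// ler_norml ?cos_geN1 ?cos_le1 ?sin_geN1 ?sin_le1.
Qed.

Lemma continuous_expR_comb g a b : continuous (expR_comb g a b).
Proof.
move=> x; apply: differentiable_continuous; apply/derivable1_diffP.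
by have [] := is_derive_expR_comb g a b x.
Qed.

Lemma continuous_trig_comb l a b c : continuous (trig_comb l a b c).
Proof.
move=> x; apply: differentiable_continuous; apply/derivable1_diffP.
by have [] := is_derive_trig_comb l a b c x.
Qed.

(* A solution of f'' = g^2 f on ]-oo, l], continued beyond l as a bounded
   C^2 function. *)
Definition exit_leg g a b l x :=
  let f k := expR_comb g (g ^+ k * a) ((- g) ^+ k * b) l in
  if x <= l then expR_comb g a b x
  else trig_comb l (- f 2) (f 1) (f 0 + f 2) x.

Definition exit_leg1 g a b l x :=
  let f k := expR_comb g (g ^+ k * a) ((- g) ^+ k * b) l in
  if x <= l then expR_comb g (g * a) (- (g * b)) x
  else trig_comb l (f 1) (f 2) 0 x.

Definition exit_leg2 g a b l x :=
  let f k := expR_comb g (g ^+ k * a) ((- g) ^+ k * b) l in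
  if x <= l then expR_comb g (g * (g * a)) (- (g * - (g * b))) x
  else trig_comb l (f 2) (- f 1) 0 x.

Lemma derive1_eq (f df : R -> R) : (forall x : R, is_derive x 1 f (df x)) ->
  derive1 f = df.
Proof. by move=> H; apply/funext => x; rewrite derive1E; have [] := H x. Qed.

Lemma trig_comb_at l a b c : trig_comb l a b c l = a + c.
Proof. by rewrite /trig_comb subrr cos0 sin0 mulr1 mulr0 addr0. Qed.

(** Here [f k] is the k-th derivative at [l] of the exponential branch. The trigonometric branch has
    value [- f 2 + (f 0 + f 2)] and successive derivatives [f 1], [f 2] at [l], so the branches
    match to second order. *)
Lemma is_derive_exit_leg g a b l x :
  is_derive x 1 (exit_leg g a b l) (exit_leg1 g a b l x).
Proof.
rewrite /exit_leg /exit_leg1; apply: is_derive_glue => [{}x|{}x||].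
- exact: is_derive_expR_comb.
- by apply: is_derive_eq (is_derive_trig_comb _ _ _ _ _) _; rewrite opprK.
- by rewrite trig_comb_at /= !expr0 !mul1r; ring.
- by rewrite trig_comb_at /expR_comb; ring.
Qed.

Lemma is_derive_exit_leg1 g a b l x :
  is_derive x 1 (exit_leg1 g a b l) (exit_leg2 g a b l x).
Proof.
rewrite /exit_leg1 /exit_leg2; apply: is_derive_glue => [{}x|{}x||].
- exact: is_derive_expR_comb.
- exact: is_derive_trig_comb.
- by rewrite trig_comb_at /expR_comb; ring.
- by rewrite trig_comb_at /expR_comb; ring.
Qed.

Lemma continuous_exit_leg2 g a b l : continuous (exit_leg2 g a b l).
Proof.
apply: continuous_glue; first exact: continuous_expR_comb.
  exact: continuous_trig_comb.
by rewrite trig_comb_at /expR_comb; ring.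
Qed.

Lemma exit_leg_bound g a b l : 0 <= g ->
  exists M, forall x, 0 <= x -> `|exit_leg g a b l x| <= M.
Proof.
move=> g0; set f := fun k => expR_comb g (g ^+ k * a) ((- g) ^+ k * b) l.
exists (Num.max (`|a| * expR (g * l) + `|b|)
          (`|- f 2| + `|f 1| + `|f 0 + f 2|)) => x x0.
rewrite /exit_leg le_max; case: ifP => xl.
  by rewrite expR_comb_bound ?x0.
by rewrite trig_comb_bound orbT.
Qed.

Lemma exit_leg2_bound g a b l : 0 <= g ->
  exists M, forall x, 0 <= x -> `|exit_leg2 g a b l x| <= M.
Proof.
move=> g0; set f := fun k => expR_comb g (g ^+ k * a) ((- g) ^+ k * b) l.
exists (Num.max (`|g * (g * a)| * expR (g * l) + `|- (g * - (g * b))|)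
          (`|f 2| + `|- f 1| + `|0 : R|)) => x x0.
rewrite /exit_leg2 le_max; case: ifP => xl.
  by rewrite expR_comb_bound ?x0.
by rewrite trig_comb_bound orbT.
Qed.

End ExitFunction.

(** * The exit function belongs to the domain of the generator *)

Section ExitGenerator.
Context {R : realType} {N : nat}.
Hypothesis hN : (2 <= N)%N.
Variables (lam l : R).
Hypotheses (lam0 : 0 < lam) (l0 : 0 <= l).

Let g : R := Num.sqrt (2 * lam).
Let r : R := 1 - 2 / N%:R.

Definition exit_profile (lam : R) (x : R) : R :=
  expR (Num.sqrt (2 * lam) * x) - (1 - 2 / N%:R) * expR (- (Num.sqrt (2 * lam) * x)).

Definition exit_fun : spider_fun R N := fun i =>
  if nat_of_ord i == 0%N then exit_leg g 1 (- r) l else expR_comb g 0 (1 - r).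

Definition exit_fun1 : spider_fun R N := fun i =>
  if nat_of_ord i == 0%N then exit_leg1 g 1 (- r) l
  else expR_comb g (g * 0) (- (g * (1 - r))).

Definition exit_fun2 : spider_fun R N := fun i =>
  if nat_of_ord i == 0%N then exit_leg2 g 1 (- r) l
  else expR_comb g (g * (g * 0)) (- (g * (- (g * (1 - r))))).

Let is_derive_exit_fun i (x : R) : is_derive x 1 (exit_fun i) (exit_fun1 i x).
Proof.
rewrite /exit_fun /exit_fun1; case: ifP => _; first exact: is_derive_exit_leg.
exact: is_derive_expR_comb.
Qed.

Let is_derive_exit_fun1 i (x : R) : is_derive x 1 (exit_fun1 i) (exit_fun2 i x).
Proof.
rewrite /exit_fun1 /exit_fun2; case: ifP => _; first exact: is_derive_exit_leg1.
exact: is_derive_expR_comb.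
Qed.

Let d2_exit_fun : d2 exit_fun = exit_fun2.
Proof.
apply/funext => i; rewrite /d2 (derive1_eq _ _ (is_derive_exit_fun i)).
exact: derive1_eq (is_derive_exit_fun1 i).
Qed.

Let g2 : g ^+ 2 = 2 * lam. Proof. by rewrite sqr_sqrtr// mulr_ge0// ltW. Qed.
Let g0 : 0 <= g. Proof. exact: sqrtr_ge0. Qed.

Lemma exit_fun_eigen (i : 'I_N) x : (nat_of_ord i = 0%N -> x <= l) ->
  2^-1 * d2 exit_fun i x = lam * exit_fun i x.
Proof.
rewrite d2_exit_fun /exit_fun2 /exit_fun.
have -> : lam = 2^-1 * g ^+ 2 by rewrite g2 mulKf.
have [i0 /(_ i0) xl|i0 _] := eqVneq (nat_of_ord i) 0%N.
  by rewrite /exit_leg /exit_leg2 xl /expR_comb; ring.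
by rewrite /expR_comb; ring.
Qed.

Lemma exit_fun_profile (i : 'I_N) x : nat_of_ord i = 0%N -> x <= l ->
  exit_fun i x = exit_profile lam x.
Proof.
move=> i0 xl; rewrite /exit_fun i0 eqxx /exit_leg xl /exit_profile /expR_comb.
by rewrite mul1r mulNr.
Qed.

Lemma exit_fun_vertex (i : 'I_N) : exit_fun i 0 = 2 / N%:R.
Proof.
rewrite /exit_fun; case: ifP => _.
  by rewrite /exit_leg l0 /expR_comb mulr0 oppr0 expR0 /r; ring.
by rewrite /expR_comb mulr0 oppr0 expR0 /r; ring.
Qed.

Lemma exit_fun_gen_dom : gen_dom exit_fun.
Proof.
have d1 i := derive1_eq _ _ (is_derive_exit_fun i).
split; first by move=> i j; rewrite !exit_fun_vertex.
split; first by move=> i x; have [] := is_derive_exit_fun i x.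
split; first by move=> i x; rewrite d1; have [] := is_derive_exit_fun1 i x.
split.
  move=> i; rewrite d2_exit_fun /exit_fun2; case: ifP => _.
    exact: continuous_exit_leg2.
  exact: continuous_expR_comb.
split.
  have [M1 b1] := exit_leg_bound g 1 (- r) l g0.
  have [M2 b2] := exit_leg2_bound g 1 (- r) l g0.
  exists (Num.max (Num.max M1 M2) (Num.max `|1 - r| `|- (g * (- (g * (1 - r))))|)).
  move=> i x x0; rewrite d2_exit_fun /exit_fun /exit_fun2 !le_max.
  case: ifP => _; first by rewrite b1// b2// orbT.
  rewrite mulr0 mulr0.
  have B b : `|expR_comb g 0 b x| <= `|b|.
    apply: (le_trans (expR_comb_bound g 0 b x x g0 _)); first by rewrite x0 lexx.
    by rewrite normr0 mul0r add0r.
  by rewrite !B !orbT.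
split.
  move=> i j; have H k : d2 exit_fun k 0 = 2 * (lam * (2 / N%:R)).
    by rewrite -(exit_fun_vertex k) -exit_fun_eigen// mulrA divff// mul1r.
  by rewrite !H.
(* Kirchhoff's condition: the slope [g * (1 + r)] on leg l_1 balances the [N - 1] slopes
   [- g * (1 - r)], because [1 - r = 2 / N]. This is what fixes [r]. *)
have N0 : (0 < N)%N by exact: ltnW.
rewrite (bigD1 (Ordinal N0))//= d1 /exit_fun1/= /exit_leg1 l0.
rewrite (eq_bigr (fun=> - (g * (1 - r)))); last first.
  move=> i iN0; rewrite d1 /exit_fun1 ifN; last first.
    by apply: contra iN0 => /eqP i0; apply/eqP/val_inj.
  by rewrite /expR_comb !mulr0 oppr0 expR0 mul0r add0r mulr1.
rewrite sumr_const cardC1 card_ord /expR_comb mulr0 oppr0 expR0 /r.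
rewrite -[X in _ + X = _]mulr_natr -subn1 natrB//.
by field; rewrite pnatr_eq0 -lt0n.
Qed.

End ExitGenerator.

(** * Continuous approximation of the indicator of not being above a level *)

Section BelowLevel.
Context {R : realType} {N : nat}.
Implicit Types (p : 'I_N * R) (lev : R).

(** All points of the other legs count as below, since the hitting time puts no condition on
    them. *)
Definition below lev p := (nat_of_ord p.1 != 0%N) || (p.2 <= lev).

(** The martingale problem only admits continuous test functions; these equal 1 exactly where
    [below] holds and decay to 0 elsewhere as [k] grows. *)
Definition soft_below lev (k : nat) : spider_fun R N := fun i x =>
  if nat_of_ord i == 0%N then expR (- (k%:R * Num.max 0 (x - lev))) else 1.

Lemma soft_below_itv lev k p : 0 <= ev (soft_below lev k) p <= 1.
Proof.
rewrite /ev /soft_below; case: ifP => _; last by rewrite ler01 lexx.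
by rewrite expR_ge0/= -expR0 ler_expR oppr_le0 mulr_ge0// le_max lexx.
Qed.

Lemma spider_test_soft_below lev k : 0 <= lev -> spider_test (soft_below lev k).
Proof.
move=> lev0; split.
  have H i : soft_below lev k i 0 = 1.
    rewrite /soft_below; case: ifP => // _.
    have /max_idPl -> : 0 - lev <= 0 by rewrite sub0r oppr_le0.
    by rewrite mulr0 oppr0 expR0.
  by move=> i j; rewrite !H.
split.
  move=> i; rewrite /soft_below; case: (_ == _) => x; last exact: cst_continuous.
  apply: (@continuous_comp _ _ _ (fun x => - (k%:R * Num.max 0 (x - lev))) expR);
    last exact: continuous_expR.
  apply: cvgN; apply: cvgM; first exact: cvg_cst.
  apply: (@continuous_max _ _ (cst 0) (fun x => x - lev)); first exact: cvg_cst.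
  by apply: cvgB; [exact: cvg_id|exact: cvg_cst].
exists 1 => i x _; have /andP[? ?] := soft_below_itv lev k (i, x).
by rewrite ger0_norm.
Qed.

Lemma cvg_soft_below lev p :
  (fun k => ev (soft_below lev k) p) @ \oo --> ((below lev p)%:R : R).
Proof.
rewrite /ev /soft_below /below; case: eqP => _ /=; last exact: cvg_cst.
case: leP => xl.
  have /max_idPl -> : p.2 - lev <= 0 by rewrite subr_le0.
  by under eq_fun do rewrite mulr0 oppr0 expR0; exact: cvg_cst.
have x0 : 0 < p.2 - lev by rewrite subr_gt0.
have /max_idPr -> := ltW x0.
(* Above the level the values form a geometric sequence of ratio e^(-(x - lev)) < 1. *)
under eq_fun do rewrite -mulrN expRM_natl.
apply: cvg_expr; rewrite ger0_norm ?expR_ge0// -expR0 ltr_expR oppr_lt0//.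
Qed.

End BelowLevel.

(** * Martingale increments killed above a level *)

Section KilledMartingale.
Context {R : realType} {N : nat} {d} {Omega : measurableType d}.
Variables (P : probability Omega R) (b : R -> Omega -> 'I_N * R).
Hypothesis hb : spider_BM P b.
Variable f : spider_fun R N.
Hypothesis hf : gen_dom f.
Variable o : 'I_N.

Let b_ge0 t w : 0 <= (b t w).2. Proof. by case: hb. Qed.
Let b_meas t i : measurable_fun setT (fun w => leg_coord i (b t w)).
Proof. by case: hb => _ [+ _]; apply. Qed.
Let b_cont w : spider_path_continuous (b ^~ w).
Proof. by case: hb => _ [_ [_ [+ _]]]; apply. Qed.
Let f0 i j : f i 0 = f j 0. Proof. by case: hf. Qed.
Let f20 i j : d2 f i 0 = d2 f j 0. Proof. by case: hf => _ [_ [_ [_ [_ []]]]]. Qed.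
Let f_cont i : continuous (f i).
Proof.
case: hf => _ [df _] x; apply: differentiable_continuous.
exact/derivable1_diffP.
Qed.
Let f2_cont i : continuous (d2 f i). Proof. by case: hf => _ [_ [_ []]]. Qed.

Definition drift (p : 'I_N -> R -> R) (beta : R -> 'I_N * R) (t : R) : R :=
  \int[lebesgue_measure]_(u in `[0, t]) (2^-1 * ev (d2 p) (beta u)).

(** The process [M] of the martingale problem in [spider_BM], written for a single path. *)
Definition dynkin (p : 'I_N -> R -> R) (beta : R -> 'I_N * R) (t : R) : R :=
  ev p (beta t) - drift p beta t.

Let G w (u : R) : R := 2^-1 * ev (d2 f) (b `|u| w).

Let G_cont w : continuous (G w).
Proof.
move=> u; apply: cvgM; first exact: cvg_cst.
exact: (continuous_ev (b ^~ w)).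
Qed.

Let drift_abs w t : drift f (b ^~ w) t = \int[lebesgue_measure]_(u in `[0, t]) G w u.
Proof.
apply: eq_Rintegral => u; rewrite inE/= in_itv/= => /andP[u0 _].
by rewrite /G ger0_norm.
Qed.

Lemma measurable_dynkin t : 0 <= t -> measurable_fun setT (fun w => dynkin f (b ^~ w) t).
Proof.
move=> t0.
apply: measurable_funB.
  by apply: (measurable_ev _ _ o).
apply: (measurable_fun_cvg (h := fun n w =>
  \sum_(j < n) (t / n%:R * G w (j%:R * (t / n%:R))))).
  move=> n; apply: measurable_sum => j; apply: measurable_funM => //.
  apply: measurable_funM => //.
  by apply: (measurable_ev _ _ o).
by move=> w _; rewrite drift_abs; exact: cvg_riemann_sum.
Qed.

(** The constant is crude; what matters is that it is uniform in the path, so that it can serve as a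
    dominating bound. *)
Lemma dynkin_increment_bound (M : R) w s t : 0 <= s -> s <= t ->
  (forall i x, 0 <= x -> `|d2 f i x| <= M) ->
  `|drift f (b ^~ w) t - drift f (b ^~ w) s| <= (t - s) * (2 * M).
Proof.
move=> s0 st bM; rewrite !drift_abs.
have GM u : `|G w u| <= 2^-1 * M.
  by rewrite normrM ger0_norm ?invr_ge0// ler_wpM2l ?invr_ge0// bM.
have M0 : 0 <= M by apply: le_trans (normr_ge0 _) (bM (b 0 w).1 0 (lexx 0)).
have H : forall u, s <= u <= t -> `|G w u - G w s| <= M.
  move=> u _; rewrite (le_trans (ler_normB _ _))// (splitr M).
  by rewrite lerD// mulrC.
have := integral_increment (G w) s t M (G_cont w) s0 st H.
move=> /(le_trans (lerB_dist _ _)); rewrite lerBlDr => /le_trans; apply.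
rewrite normrM (ger0_norm (_ : 0 <= t - s)) ?subr_ge0//.
have -> : (t - s) * (2 * M) = M * (t - s) + (t - s) * M by ring.
rewrite lerD2l ler_wpM2l ?subr_ge0// (le_trans (GM s))// mulrC ler_piMr//.
by rewrite invf_le1// ler1n.
Qed.

Let f_bound : exists M, 0 <= M /\
  forall i x, 0 <= x -> `|f i x| <= M /\ `|d2 f i x| <= M.
Proof.
case: hf => _ [_ [_ [_ [[M bM] _]]]]; exists M; split=> //.
by have [H _] := bM o 0 (lexx 0); exact: le_trans (normr_ge0 _) H.
Qed.

Variable lev : R.
Hypothesis lev0 : 0 <= lev.

Let prod_itv (g : spider_fun R N) (times : seq R) w :
  (forall p, 0 <= ev g p <= 1) -> 0 <= \prod_(u <- times) ev g (b u w) <= 1.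
Proof.
move=> g01; elim: times => [|u times IH]; first by rewrite big_nil ler01 lexx.
have /andP[? ?] := IH; have /andP[? ?] := g01 (b u w).
by rewrite big_cons mulr_ge0// mulr_ile1.
Qed.

Let measurable_prod_test k (times : seq R) :
  measurable_fun setT (fun w => \prod_(u <- times) ev (soft_below lev k) (b u w)).
Proof.
have [g0 [gc _]] := @spider_test_soft_below R N lev k lev0.
elim: times => [|u times IH].
  by under eq_fun do rewrite big_nil; exact: measurable_cst.
under eq_fun do rewrite big_cons.
by apply: measurable_funM => //; exact: (measurable_ev _ _ o).
Qed.

(** With [soft_below lev k] in place of the indicator, the martingale problem gives mean zero
    directly. The products lie in [0, 1] and the increment is bounded, so bounded convergence in [k]
    passes to the indicator. *)
Lemma killed_increment (times : seq R) s t : 0 <= s -> s <= t ->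
  (forall u, u \in times -> 0 <= u <= s) ->
  let X w := (dynkin f (b ^~ w) t - dynkin f (b ^~ w) s) *
    \prod_(u <- times) ((below lev (b u w))%:R) in
  centred P X.
Proof.
move=> s0 st ht X.
have t0 : 0 <= t := le_trans s0 st.
pose D w := dynkin f (b ^~ w) t - dynkin f (b ^~ w) s.
pose Y k w := D w * \prod_(u <- times) ev (soft_below lev k) (b u w).
have mY k : measurable_fun setT (Y k).
  apply: measurable_funM; last exact: measurable_prod_test.
  by apply: measurable_funB; exact: measurable_dynkin.
have [M [M0 bM]] := f_bound.
pose C := M + M + (t - s) * (2 * M).
have bD w : `|D w| <= C.
  have -> : D w = (ev f (b t w) - ev f (b s w)) -
      (drift f (b ^~ w) t - drift f (b ^~ w) s) by rewrite /D /dynkin; ring.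
  rewrite (le_trans (ler_normB _ _))// lerD//.
    by rewrite (le_trans (ler_normB _ _))// lerD//; exact: (bM _ _ (b_ge0 _ _)).1.
  by apply: dynkin_increment_bound => // i x x0; exact: (bM _ _ x0).2.
have C0 w : 0 <= C := le_trans (normr_ge0 _) (bD w).
have bY k w : `|Y k w| <= C.
  rewrite normrM -[leRHS]mulr1 ler_pM//.
  have /andP[? ?] := prod_itv _ times w (soft_below_itv lev k).
  by rewrite ger0_norm.
have YX w : Y ^~ w @ \oo --> X w.
  apply: cvgM; first exact: cvg_cst.
  apply: cvg_big => [|u _]; first exact: mul_continuous.
  exact: cvg_soft_below.
have EY k : \int[P]_w Y k w = 0.
  case: hb => _ [_ [_ [_ /(_ f hf s t s0 st)]]].
  move=> /(_ [seq (soft_below lev k, u) | u <- times]) /= H.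
  rewrite -[RHS]H; last first.
    move=> p /mapP[u uin ->]; split; last exact: ht.
    exact: spider_test_soft_below.
  by apply: eq_Rintegral => w _; rewrite big_map.
split.
- exact: (measurable_fun_cvg mY (fun w _ => YX w)).
- exists C => w; apply: (ler_cvg_to (cvg_norm (YX w)) (cvg_cst C)).
  by apply: nearW => k; exact: bY.
- have := bounded_convergence P Y X C mY bY YX.
  under eq_fun do rewrite EY.
  by move=> /cvg_lim <-//; rewrite lim_cst.
Qed.

End KilledMartingale.

(** * Abel summation, stopping along a grid and discrete discounting *)

Section DiscreteStopping.
Context {R : realType}.
Implicit Types (F I Phi : nat -> R) (c : nat -> bool).

(* Abel summation against the weights q^k, where q^k - q^(k+1) = c q^(k+1). *)
Lemma discounted_sum (q c : R) F I m : q * (1 + c) = 1 ->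
  \sum_(k < m) q ^+ k.+1 * (F k.+1 - F k - I k) =
  q ^+ m * F m - F 0%N + \sum_(k < m) q ^+ k.+1 * (c * F k - I k).
Proof.
move=> qc; elim: m => [|m IH]; first by rewrite !big_ord0 expr0; ring.
rewrite !big_ord_recr/= IH.
have -> : q ^+ m * F m = q ^+ m.+1 * (1 + c) * F m.
  by rewrite exprSr -(mulrA _ q) qc mulr1.
ring.
Qed.

Lemma prod_bool (s : seq nat) c : \prod_(j <- s) (c j)%:R = (all c s)%:R :> R.
Proof.
elim: s => [|j s IH]; first by rewrite big_nil.
by rewrite big_cons IH -natrM mulnb.
Qed.

(** The index [m] is the first failure of [c] before [n], or [n] if there is none. The product at
    [k] includes [c k] itself, so the sum stops just before the term of index [m]. *)
Lemma stopped_sum c Phi n : exists m, [/\ (m <= n)%N,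
  forall j, (j < m)%N -> c j, (m < n)%N -> ~~ c m &
  \sum_(k < n) Phi k * \prod_(j <- iota 0 k.+1) (c j)%:R = \sum_(k < m) Phi k].
Proof.
elim: n => [|n [m [mn cm ncm IH]]]; first by exists 0%N; split=> //; rewrite !big_ord0.
rewrite big_ord_recr/= IH prod_bool.
have [cS|cS] := boolP (all c (iota 0 n.+1)).
  have mE : m = n.
    apply/eqP; rewrite eqn_leq mn leqNgt; apply/negP => mn'.
    move/allP: cS => /(_ m); rewrite mem_iota/= add0n ltnS => /(_ mn) cm'.
    by move: (ncm mn'); rewrite cm'.
  exists n.+1; split=> //; last by rewrite big_ord_recr/= mE mulr1.
    by move=> j jn; move/allP: cS; apply; rewrite mem_iota.
  by rewrite ltnn.
exists m; split=> //; [exact: leqW| |by rewrite mulr0 addr0].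
rewrite ltnS leq_eqVlt => /orP[/eqP mE|]; last exact: ncm.
apply: contra cS => cm'; apply/allP => j; rewrite mem_iota/= add0n ltnS.
by rewrite -mE leq_eqVlt => /orP[/eqP->|/cm].
Qed.

(** The lower bound is 1 + x <= e^x. The upper one applies the same inequality to 1/(1 + x) = 1 -
    x/(1 + x), together with x/(1 + x) >= x - x^2. *)
Lemma discount_bounds (x : R) m : 0 <= x ->
  expR (- (m%:R * x)) <= (1 + x)^-1 ^+ m <=
  expR (- (m%:R * x)) * expR (m%:R * x ^+ 2).
Proof.
move=> x0; have x1 : 0 < 1 + x by rewrite ltr_pwDl.
have i0 : 0 <= (1 + x)^-1 by rewrite invr_ge0 ltW.
rewrite -expRD -mulrN -mulrDr !expRM_natl; apply/andP; split.
  rewrite lerXn2r ?nnegrE ?expR_ge0// expRN lef_pV2 ?posrE ?expR_gt0//.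
  exact: expR_ge1Dx.
rewrite lerXn2r ?nnegrE ?expR_ge0//.
have -> : (1 + x)^-1 = 1 + - (x / (1 + x)) by field; rewrite gt_eqF.
rewrite (le_trans (expR_ge1Dx _))// ler_expR lerNl opprD opprK.
rewrite ler_pdivlMr//.
have -> : (x - x ^+ 2) * (1 + x) = x - x ^+ 3 by ring.
by rewrite gerBl exprn_ge0.
Qed.

End DiscreteStopping.

(** * The discounted killed sum: stopped form, mean and bound *)

Section KilledSum.
Context {R : realType} {N : nat} {d} {Omega : measurableType d}.
Variables (P : probability Omega R).

Lemma centred_sum n (a : nat -> R) (X : nat -> Omega -> R) :
  (forall k, centred P (X k)) -> centred P (fun w => \sum_(k < n) a k * X k w).
Proof.
move=> cX; elim: n => [|n [mS [C bS] ES]].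
  have -> : (fun w => \sum_(k < 0) a k * X k w) = cst 0.
    by apply/funext => w; rewrite big_ord0.
  split; [exact: measurable_cst|by exists 0 => w; rewrite normr0|].
  by rewrite Rintegral_cst// mul0r.
have [mX [D bX] EX] := cX n.
have iS := bounded_measurable_integrable P _ C mS bS.
have iX := bounded_measurable_integrable P _ D mX bX.
have maX : measurable_fun setT (fun w => a n * X n w) by exact: measurable_funM.
have baX w : `|a n * X n w| <= `|a n| * D by rewrite normrM ler_wpM2l.
have -> : (fun w => \sum_(k < n.+1) a k * X k w) =
    (fun w => \sum_(k < n) a k * X k w + a n * X n w).
  by apply/funext => w; rewrite big_ord_recr.
split; [by apply: measurable_funD| |].
  by exists (C + `|a n| * D) => w; rewrite (le_trans (ler_normD _ _))// lerD.
rewrite RintegralD//; last exact: bounded_measurable_integrable maX baX.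
by rewrite ES RintegralZl// EX mulr0 addr0.
Qed.

Variable b : R -> Omega -> 'I_N * R.
Hypothesis hb : spider_BM P b.
Variable f : spider_fun R N.
Hypothesis hf : gen_dom f.
Variables (o : 'I_N) (lam lev T : R).
Hypotheses (lam0 : 0 < lam) (lev0 : 0 <= lev) (T0 : 0 <= T).

(** A martingale transform: the increment from time [k%:R * h] to the next grid time carries a
    weight depending only on grid times up to [k%:R * h], so each term is centred. *)
Definition killed_sum (n : nat) (w : Omega) : R :=
  let h := T / n%:R in let q := (1 + lam * h)^-1 in
  \sum_(k < n) q ^+ k.+1 *
    ((dynkin f (b ^~ w) (k.+1%:R * h) - dynkin f (b ^~ w) (k%:R * h)) *
     \prod_(u <- [seq j%:R * h | j <- iota 0 k.+1]) (below lev (b u w))%:R).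

(** Stopping the sum and then applying the Abel summation leaves the discounted value of [f] at the
    stopping time, its initial value, and a residual that compares [lam * h * f] with the drift over
    each cell. *)
Lemma killed_sum_stopped n w :
  let h := T / n%:R in let q := (1 + lam * h)^-1 in
  exists m, [/\ (m <= n)%N,
    forall j, (j < m)%N -> below lev (b (j%:R * h) w),
    (m < n)%N -> ~~ below lev (b (m%:R * h) w) &
    killed_sum n w = q ^+ m * ev f (b (m%:R * h) w) - ev f (b 0 w) +
      \sum_(k < m) q ^+ k.+1 * (lam * h * ev f (b (k%:R * h) w) -
        (drift f (b ^~ w) (k.+1%:R * h) - drift f (b ^~ w) (k%:R * h)))].
Proof.
move=> h q.
have h0 : 0 <= h by rewrite divr_ge0.
have [m [mn cm ncm E]] := stopped_sum
  (fun j => below lev (b (j%:R * h) w))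
  (fun k => q ^+ k.+1 * (dynkin f (b ^~ w) (k.+1%:R * h) -
     dynkin f (b ^~ w) (k%:R * h))) n.
exists m; split=> //.
rewrite /killed_sum -/h -/q.
under eq_bigr do rewrite big_map mulrA.
rewrite E.
have qE : q * (1 + lam * h) = 1.
  by rewrite mulVf// gt_eqF// ltr_pwDl// mulr_ge0// ltW.
(* Writes time 0 as grid time of index 0, to match [F 0%N] in the Abel summation. *)
rewrite -[in ev f (b 0 w)](mul0r h).
rewrite -(discounted_sum q (lam * h) (fun k => ev f (b (k%:R * h) w))
  (fun k => drift f (b ^~ w) (k.+1%:R * h) - drift f (b ^~ w) (k%:R * h)))//.
by apply: eq_bigr => k _; congr (_ * _); rewrite /dynkin; ring.
Qed.

Lemma killed_sum_centred n : centred P (killed_sum n).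
Proof.
set h := T / n%:R; set q := (1 + lam * h)^-1.
have h0 : 0 <= h by rewrite divr_ge0.
apply: (centred_sum n (fun k => q ^+ k.+1) (fun k w =>
    ((dynkin f (b ^~ w) (k.+1%:R * h) - dynkin f (b ^~ w) (k%:R * h)) *
     \prod_(u <- [seq j%:R * h | j <- iota 0 k.+1]) (below lev (b u w))%:R))) => k.
apply: (killed_increment P b hb f hf o lev lev0).
- by rewrite mulr_ge0.
- by rewrite ler_wpM2r// ler_nat.
- move=> u /mapP[j]; rewrite mem_iota/= add0n ltnS => jk ->.
  by rewrite mulr_ge0//= ler_wpM2r// ler_nat.
Qed.

(** In the stopped form the two boundary terms are bounded by [M], and at most [n] residuals of
    order [h = T / n] remain. *)
Lemma killed_sum_bound : exists C, forall n w, `|killed_sum n w| <= C.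
Proof.
have [M [M0 bM]] : exists M, 0 <= M /\
    forall i x, 0 <= x -> `|f i x| <= M /\ `|d2 f i x| <= M.
  case: hf => _ [_ [_ [_ [[M bM] _]]]]; exists M; split=> //.
  by have [H _] := bM o 0 (lexx 0); exact: le_trans (normr_ge0 _) H.
have b_ge0 t w : 0 <= (b t w).2 by case: hb.
have bF t w : `|ev f (b t w)| <= M by exact: (bM _ _ (b_ge0 t w)).1.
exists (M + M + T * (lam * M + 2 * M)) => n w.
have [m [mn _ _ ->]] := killed_sum_stopped n w.
set h := T / n%:R; set q := (1 + lam * h)^-1.
have h0 : 0 <= h by rewrite divr_ge0.
have q01 k : 0 <= q ^+ k <= 1.
  have x1 : 1 <= 1 + lam * h by rewrite lerDl mulr_ge0// ltW.
  rewrite exprn_ge0 ?invr_ge0 ?(le_trans ler01)//= exprn_ile1//.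
    by rewrite invr_ge0 (le_trans ler01).
  by rewrite invf_le1 ?(lt_le_trans ltr01).
have bq k (x : R) : `|q ^+ k * x| <= `|x|.
  by have /andP[? ?] := q01 k; rewrite normrM ger0_norm// ler_piMl.
rewrite (le_trans (ler_normD _ _))// lerD//.
  rewrite (le_trans (ler_normB _ _))// lerD//.
  exact: le_trans (bq _ _) (bF _ _).
rewrite (le_trans (ler_norm_sum _ _ _))//.
apply: (@le_trans _ _ (\sum_(k < m) h * (lam * M + 2 * M))).
  apply: ler_sum => k _; rewrite (le_trans (bq _ _))// mulrDr.
  rewrite (le_trans (ler_normB _ _))// lerD//.
    rewrite normrM ger0_norm ?mulr_ge0 ?(ltW lam0)//.
    by rewrite [h * _]mulrCA mulrA ler_wpM2l// mulr_ge0 ?(ltW lam0).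
  have kS : k.+1%:R * h - k%:R * h = h by rewrite -mulrBl -natrB// subSnn mul1r.
  rewrite -[X in _ <= X * _]kS; apply: (dynkin_increment_bound P b hb f hf) => //.
  - by rewrite mulr_ge0.
  - by rewrite ler_wpM2r// ler_nat.
  - by move=> i x x0; exact: (bM _ _ x0).2.
rewrite sumr_const card_ord -mulrnAl ler_wpM2r//.
  by rewrite addr_ge0// mulr_ge0// ltW.
rewrite -mulr_natr /h -mulrA ler_piMr//.
(* For [n = 0] the mesh is 0, because the inverse of 0 is 0. *)
have [->|n0] := posnP n; first by rewrite invr0 mul0r ler01.
by rewrite mulrC ler_pdivrMr ?ltr0n// mul1r ler_nat.
Qed.

End KilledSum.

(** * The hitting time of a point of leg l_1 and its measurability *)

Section HittingTime.
Context {R : realType} {N : nat}.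
Variable o : 'I_N.
Hypothesis o0 : nat_of_ord o = 0%N.
Variables lam L : R.
Hypotheses (lam0 : 0 < lam) (L0 : 0 < L).

Lemma grid_floor (h t : R) : 0 < h -> 0 <= t ->
  exists j : nat, j%:R * h <= t < j.+1%:R * h.
Proof.
move=> h0 t0; have th : 0 <= t / h by rewrite divr_ge0// ltW.
by exists (Num.trunc (t / h)); rewrite -ler_pdivlMr// -ltr_pdivrMr// truncn_itv.
Qed.

(** Positivity of [x] matters: at coordinate 0 every label represents the vertex. *)
Lemma leg_coord_hit (p : 'I_N * R) (x : R) : 0 < x ->
  (nat_of_ord p.1 = 0%N /\ p.2 = x) <-> leg_coord o p = x.
Proof.
move=> x0; rewrite /leg_coord; case: eqP => [->|po]; split=> //.
- by case.
- by case=> p0 _; case: po; apply: val_inj; rewrite /= o0.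
- by move=> xE; move: x0; rewrite -xE ltxx.
Qed.

Section Path.
Variable b : R -> 'I_N * R.
Hypotheses (b_ge0 : forall t, 0 <= (b t).2) (b_cont : spider_path_continuous b).
Hypothesis b0 : (b 0).2 = 0.

Let y (u : R) : R := leg_coord o (b `|u|).
Let H := [set t | 0 <= t /\ nat_of_ord (b t).1 = 0%N /\ (b t).2 = L].

Let y_cont : continuous y. Proof. exact: continuous_leg_coord. Qed.
Let y0 : y 0 = 0. Proof. by rewrite /y normr0 /leg_coord b0; case: ifP. Qed.

Let HE t : H t <-> 0 <= t /\ y t = L.
Proof.
rewrite /H /y /=; split=> -[t0]; first by rewrite ger0_norm// => /(leg_coord_hit _ _ L0).
by rewrite ger0_norm// => /(leg_coord_hit _ _ L0).
Qed.

Let H_lb : has_lbound H. Proof. by exists 0 => t /HE[]. Qed.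

(** The infimum is attained: otherwise a hitting time close enough to [inf H] would put [L] at
    distance less than [|y (inf H) - L|] from [y (inf H)]. *)
Let inf_H : H !=set0 -> H (inf H).
Proof.
move=> Hn0; have tau0 : 0 <= inf H by apply: lb_le_inf => // t /HE[].
apply/HE; split=> //; apply/eqP; rewrite -subr_eq0 -normr_le0 leNgt; apply/negP.
move=> /(((continuous_epsP y).1 y_cont) (inf H)) [de de0 Hde].
have [t Ht tlt] := inf_adherent de0 (conj Hn0 H_lb).
have := Hde t; have [_ ->] := (HE t).1 Ht.
rewrite ltxx distrC ger0_norm; last by rewrite subr_ge0; exact: ge_inf.
by rewrite ltrBlDl => /(_ tlt).
Qed.

Lemma hit_lapP :
  (exists tau, [/\ 0 <= tau, leg_coord o (b tau) = L,
     hit_lap lam L b = expR (- (lam * tau)) &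
     forall t, 0 <= t -> leg_coord o (b t) = L -> tau <= t]) \/
  ((forall t, 0 <= t -> leg_coord o (b t) <> L) /\ hit_lap lam L b = 0).
Proof.
have yE t : 0 <= t -> leg_coord o (b t) = y t by move=> t0; rewrite /y ger0_norm.
rewrite /hit_lap -/H; case: pselect => Hn0; [left|right].
  have [tau0 tauL] := (HE _).1 (inf_H Hn0).
  exists (inf H); split=> //; first by rewrite yE.
  by move=> t t0; rewrite yE// => tL; apply: ge_inf => //; apply/HE.
by split=> // t t0; rewrite yE// => tL; apply: Hn0; exists t; apply/HE.
Qed.

Lemma hit_lap_itv : 0 <= hit_lap lam L b <= 1.
Proof.
have [[tau [tau0 _ -> _]]|[_ ->]] := hit_lapP; last by rewrite lexx ler01.
by rewrite expR_ge0/= -expR0 ler_expR oppr_le0 mulr_ge0// ltW.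
Qed.

Lemma hit_before (s : R) : 0 <= s -> L <= leg_coord o (b s) ->
  exists2 t, 0 <= t <= s & leg_coord o (b t) = L.
Proof.
move=> s0 sL; have sL' : L <= y s by rewrite /y ger0_norm.
have yw : {within `[0, s], continuous y} by exact: continuous_subspaceT.
have [|t] := IVT (v := L) s0 yw.
  rewrite y0 ge_min (ltW L0)/= le_max sL' orbT//.
rewrite in_itv/= => /andP[t0 ts] <-; exists t; first by rewrite t0.
by rewrite /y ger0_norm.
Qed.

(** The left side says that the hitting time is at most [s]. By continuity this is a condition on
    countably many times, which yields measurability; capping by [s] keeps the sampled times in the
    interval. *)
Lemma le_hit_lapP (s : R) : 0 <= s ->
  expR (- (lam * s)) <= hit_lap lam L b <->
  forall m : nat, exists n j : nat,
    L - m.+1%:R^-1 < leg_coord o (b (Num.min s (j%:R / n.+1%:R))).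
Proof.
move=> s0.
have -> : (expR (- (lam * s)) <= hit_lap lam L b) =
    `[< exists2 t, 0 <= t <= s & leg_coord o (b t) = L >].
  apply/idP/asboolP => [|[t /andP[t0 ts] tL]].
    have [[tau [tau0 tauL -> _]]|[_ ->]] := hit_lapP; last by rewrite leNgt expR_gt0.
    rewrite ler_expR lerN2 ler_pM2l// => taus.
    by exists tau; rewrite ?tau0.
  have [[tau [tau0 tauL -> taule]]|[nhit _]] := hit_lapP; last by case: (nhit t).
  by rewrite ler_expR lerN2 ler_pM2l// (le_trans _ ts)// taule.
split=> [/asboolP[t /andP[t0 ts] tL] m|Hm].
  have tL' : y t = L by rewrite /y ger0_norm.
  have m0 : (0 : R) < m.+1%:R^-1 by rewrite invr_gt0.
  have [de de0 Hde] := (continuous_epsP y).1 y_cont t _ m0.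
  near \oo => n.
  have hn : n.+1%:R^-1 < de :> R by near: n; exact: near_invS_lt.
  have n0 : 0 < n.+1%:R^-1 :> R by rewrite invr_gt0.
  have [j /andP[jt tj]] := grid_floor _ t n0 t0.
  exists n, j; have /min_idPr -> := le_trans jt ts.
  have jn0 : 0 <= j%:R / n.+1%:R :> R by rewrite divr_ge0.
  have := Hde (j%:R / n.+1%:R); rewrite tL' /y (ger0_norm jn0).
  rewrite ger0_norm ?subr_ge0// => H1; rewrite ltrBlDl -ltrBlDr.
  apply: (le_lt_trans (ler_norm _)); apply: H1; apply: lt_trans hn.
  by rewrite ltrBlDl (lt_le_trans tj)// -natr1 mulrDl mul1r.
apply/asboolP.
(* Conversely the maximum over the interval is attained; it exceeds every [L - 1/(m+1)], so it is at
   least [L], and the intermediate value theorem gives a hit. *)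
have yw : {within `[0, s], continuous y} by exact: continuous_subspaceT.
have [c] := EVT_max s0 yw; rewrite in_itv/= => /andP[c0 cs] cmax.
have cL : L <= leg_coord o (b c).
  apply/ler_addgt0Pr => e e0; near \oo => m.
  have me : m.+1%:R^-1 < e by near: m; exact: near_invS_lt.
  have [n [j Hnj]] := Hm m.
  set u := Num.min s _ in Hnj.
  have u0 : 0 <= u by rewrite le_min s0 divr_ge0.
  have us : u <= s by rewrite ge_min lexx.
  have := cmax u; rewrite in_itv/= u0 us /y !ger0_norm// => /(_ isT) uc.
  by rewrite -lerBlDr (le_trans _ uc)// (le_trans _ (ltW Hnj))// lerB// ltW.
have [t /andP[t0 tc] tL] := hit_before c c0 cL.
by exists t; rewrite ?t0 ?(le_trans tc).
Unshelve. all: by end_near. Qed.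

End Path.

Lemma measurable_hit_lap {d} {Omega : measurableType d} (b : R -> Omega -> 'I_N * R) :
  (forall t w, 0 <= (b t w).2) ->
  (forall w, spider_path_continuous (b ^~ w)) -> (forall w, (b 0 w).2 = 0) ->
  (forall t, measurable_fun setT (fun w => leg_coord o (b t w))) ->
  measurable_fun setT (fun w => hit_lap lam L (b ^~ w)).
Proof.
move=> b_ge0 b_cont b0 mb.
have H01 w := hit_lap_itv (b ^~ w) (b_ge0 ^~ w) (b_cont w).
apply: (measurability (@RGenCInfty.G R)) => [|/= _ [_] [c] -> <-].
  exact: RGenCInfty.measurableE.
rewrite setTI.
have [c0|c0] := leP c 0.
  rewrite [X in measurable X](_ : _ = setT)//; apply/seteqP; split=> // w _ /=.
  by rewrite in_itv/= andbT (le_trans c0)//; have /andP[] := H01 w.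
have [c1|c1] := ltP 1 c.
  rewrite [X in measurable X](_ : _ = set0)//; apply/seteqP; split=> // w /=.
  rewrite in_itv/= andbT => /(lt_le_trans c1); have /andP[_ /le_lt_trans H1] := H01 w.
  by move=> /H1; rewrite ltxx.
(* Chosen so that [c] is e^(-lam s); thresholds outside ]0, 1] give trivial events. *)
pose s := - ln c / lam.
have s0 : 0 <= s by rewrite divr_ge0 ?(ltW lam0)// oppr_ge0 ln_le0.
have cE : c = expR (- (lam * s)).
  by rewrite /s mulrC divfK ?gt_eqF// opprK lnK.
rewrite [X in measurable X](_ : _ = \bigcap_m \bigcup_n \bigcup_j
    [set w | L - m.+1%:R^-1 < leg_coord o (b (Num.min s (j%:R / n.+1%:R)) w)]).
  apply: bigcap_measurable; first by exists 0%N.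
  move=> m _; apply: bigcupT_measurable => n; apply: bigcupT_measurable => j.
  have := mb (Num.min s (j%:R / n.+1%:R)) measurableT _
    (measurable_itv `]L - m.+1%:R^-1, +oo[).
  rewrite setTI; congr measurable.
  by apply/seteqP; split=> w /=; rewrite in_itv/= andbT.
apply/seteqP; split=> w /=; rewrite in_itv/= andbT cE.
  move=> /(le_hit_lapP (b ^~ w) (b_ge0 ^~ w) (b_cont w) (b0 w) s s0) H m _.
  by have [n [j Hnj]] := H m; exists n => //; exists j.
move=> H; apply/(le_hit_lapP (b ^~ w) (b_ge0 ^~ w) (b_cont w) (b0 w) s s0) => m.
by have [n _ [j _ Hnj]] := H m I; exists n, j.
Qed.

End HittingTime.

(** * Pathwise estimates at the grid stopping time *)

Section ExitEstimates.
Context {R : realType} {N : nat}.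
Hypothesis hN : (2 <= N)%N.
Variable o : 'I_N.
Hypothesis o0 : nat_of_ord o = 0%N.
Variables (lam : R).
Hypotheses (lam0 : 0 < lam).

Local Notation phi := (@exit_profile R N lam).

Let r_ge0 : 0 <= 1 - 2 / N%:R :> R.
Proof.
by rewrite subr_ge0 ler_pdivrMr ?ltr0n ?(ltnW hN)// mul1r ler_nat.
Qed.

Lemma exit_profile_homo x y : x <= y -> phi x <= phi y.
Proof.
move=> xy; have gxy := ler_wpM2l (sqrtr_ge0 (2 * lam)) xy.
by rewrite /exit_profile lerB ?ler_expR// ler_wpM2l// ler_expR lerN2.
Qed.

Lemma exit_profile_gt0 x : 0 <= x -> 0 < phi x.
Proof.
move=> x0; apply: lt_le_trans (exit_profile_homo _ _ x0).
rewrite /exit_profile mulr0 oppr0 expR0 mulr1 opprB addrC subrK.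
by rewrite divr_gt0// ltr0n ltnW.
Qed.

Lemma continuous_exit_profile : continuous phi.
Proof.
have -> : phi = expR_comb (Num.sqrt (2 * lam)) 1 (- (1 - 2 / N%:R)).
  by apply/funext => x; rewrite /exit_profile /expR_comb mul1r mulNr.
exact: continuous_expR_comb.
Qed.

Lemma exit_fun_ge0 l (i : 'I_N) x : 0 <= x -> (nat_of_ord i = 0%N -> x <= l) ->
  0 <= exit_fun lam l i x.
Proof.
move=> x0 xl; have [i0|iN0] := eqVneq (nat_of_ord i) 0%N.
  by rewrite exit_fun_profile ?xl// ltW// exit_profile_gt0.
rewrite /exit_fun (negbTE iN0) /expR_comb mul0r add0r opprB addrC subrK.
by rewrite mulr_ge0 ?expR_ge0 ?divr_ge0.
Qed.

Section Path.
Variable b : R -> 'I_N * R.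
Hypotheses (b_ge0 : forall t, 0 <= (b t).2) (b_cont : spider_path_continuous b).
Hypothesis b0 : (b 0).2 = 0.
Variables (lev l T : R).
Hypotheses (lev0 : 0 <= lev) (levl : lev < l) (T0 : 0 <= T).

Let l0 : 0 <= l := le_trans lev0 (ltW levl).
Let f := exit_fun lam l : spider_fun R N.
Let hf : gen_dom f := exit_fun_gen_dom hN lam l lam0 l0.

Lemma below_leg_coord p : below lev p -> leg_coord o p <= lev.
Proof.
by rewrite /below /leg_coord; have [->|//] := eqVneq p.1 o; rewrite o0.
Qed.

Lemma leg0_leg_coord (p : 'I_N * R) : nat_of_ord p.1 = 0%N -> p.2 = leg_coord o p.
Proof.
move=> p0; rewrite /leg_coord; case: eqP => // po; case: po.
by apply: val_inj; rewrite /= o0.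
Qed.

(** Each grid point before [m] is below [lev], and the mesh is finer than the modulus for [l - lev],
    so up to the stopping time the path stays at or below [l] on leg l_1. There f''/2 = lam f, and
    the residual of a cell is controlled by the oscillation of [f] along the path. *)
Lemma drift_error e : 0 < e ->
  \forall n \near \oo, forall m, (m <= n)%N ->
    (forall j, (j < m)%N -> below lev (b (j%:R * (T / n%:R)))) ->
    (nat_of_ord (b (m%:R * (T / n%:R))).1 = 0%N -> (b (m%:R * (T / n%:R))).2 <= l) /\
    `|\sum_(k < m) (1 + lam * (T / n%:R))^-1 ^+ k.+1 *
       (lam * (T / n%:R) * ev f (b (k%:R * (T / n%:R))) -
        (drift f b (k.+1%:R * (T / n%:R)) - drift f b (k%:R * (T / n%:R))))| <= e.
Proof.
move=> e0.
have [fv [df [_ [f2c [_ [f2v _]]]]]] := hf.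
have fc i : continuous (f i).
  by move=> x; apply: differentiable_continuous; exact/derivable1_diffP.
pose F (u : R) : R := ev f (b `|u|).
pose G (u : R) : R := 2^-1 * ev (d2 f) (b `|u|).
have Fc : continuous F by exact: continuous_ev.
have Gc : continuous G.
  by move=> u; apply: cvgM; [exact: cvg_cst|exact: continuous_ev].
have yc := @continuous_leg_coord R N b b_ge0 b_cont o.
have T1 : 0 < lam * (T + 1) by rewrite mulr_gt0// ltr_wpDl.
(* The residuals add up to at most [T * lam * e1 = e * T / (T + 1)]. *)
pose e1 := e / (lam * (T + 1)).
have e10 : 0 < e1 by rewrite divr_gt0.
have [d1 d10 Hd1] := uniformly_continuous_segment F 0 T e1 Fc e10.
have ll : 0 < l - lev by rewrite subr_gt0.
have [d2 d20 Hd2] := uniformly_continuous_segment _ 0 T (l - lev) yc ll.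
near=> n => m mn bm.
have n0 : (0 < n)%N by near: n; exists 1%N.
have hd1 : T / n%:R < d1 by near: n; exact: near_mesh_lt.
have hd2 : T / n%:R < d2 by near: n; exact: near_mesh_lt.
set h := T / n%:R in bm hd1 hd2 *.
have h0 : 0 <= h by rewrite divr_ge0.
have nh : n%:R * h = T by rewrite /h mulrCA divff ?mulr1// pnatr_eq0 -lt0n.
have kh k : (k <= n)%N -> 0 <= k%:R * h <= T.
  by move=> kn; rewrite mulr_ge0//= -nh ler_wpM2r// ler_nat.
have kS k : k.+1%:R * h - k%:R * h = h by rewrite -mulrBl -natrB// subSnn mul1r.
have step k u : k%:R * h <= u <= k.+1%:R * h -> 0 <= u /\ `|k%:R * h - u| <= h.
  move=> /andP[ku uk]; have kh0 : 0 <= k%:R * h by rewrite mulr_ge0.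
  split; first exact: le_trans ku.
  by rewrite distrC ger0_norm ?subr_ge0// -[leRHS](kS k) lerB.
have low k u : (k < m)%N -> k%:R * h <= u <= k.+1%:R * h ->
    nat_of_ord (b u).1 = 0%N -> (b u).2 <= l.
  move=> km ku bu0; have [u0 ukh] := step _ _ ku.
  have kn : (k <= n)%N := leq_trans (ltnW km) mn.
  have := Hd2 (k%:R * h) u (kh k kn) (le_lt_trans ukh hd2).
  have /andP[kh0 _] := kh k kn; rewrite (ger0_norm kh0) (ger0_norm u0).
  rewrite (leg0_leg_coord _ bu0) distrC => /(le_lt_trans (ler_norm _)).
  by have := below_leg_coord _ (bm k km); lra.
split.
  (* At [m = 0] the path is at the vertex; otherwise the stopping time ends the cell that starts at
     the last grid point below [lev]. *)
  case: m mn bm low => [|m] mn bm low; first by rewrite mul0r b0.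
  by apply: (low m) => //; rewrite lexx andbT ler_wpM2r// ler_nat.
rewrite (le_trans (ler_norm_sum _ _ _))//.
apply: (@le_trans _ _ (\sum_(k < m) h * (lam * e1))).
  apply: ler_sum => k _.
  have kn : (k <= n)%N := leq_trans (ltnW (ltn_ord k)) mn.
  have /andP[kh0 khT] := kh k kn.
  have eig u : k%:R * h <= u <= k.+1%:R * h -> G u = lam * F u.
    move=> ku; have [u0 _] := step _ _ ku; rewrite /G /F ger0_norm//.
    by apply: exit_fun_eigen => //; exact: low ku.
  have kk : k%:R * h <= k%:R * h <= k.+1%:R * h.
    by rewrite lexx ler_wpM2r// ler_nat.
  have J u : drift f b u = \int[lebesgue_measure]_(v in `[0, u]) G v.
    apply: eq_Rintegral => v; rewrite inE/= in_itv/= => /andP[v0 _].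
    by rewrite /G ger0_norm.
  have x1 : 1 <= 1 + lam * h by rewrite lerDl mulr_ge0// ltW.
  rewrite normrM ger0_norm ?exprn_ge0 ?invr_ge0 ?(le_trans ler01)//.
  rewrite (le_trans (ler_piMl _ _))//.
    rewrite exprn_ile1// ?invr_ge0 ?(le_trans ler01)//.
    by rewrite invf_le1 ?(lt_le_trans ltr01).
  rewrite distrC !J.
  have -> : lam * h * ev f (b (k%:R * h)) = (k.+1%:R * h - k%:R * h) * G (k%:R * h).
    by rewrite eig// kS /F (ger0_norm kh0); ring.
  rewrite -[X in _ <= X * _](kS k) [leRHS]mulrC.
  apply: integral_increment => //; first by case/andP: kk.
  move=> u ku; rewrite !eig// -mulrBr normrM (gtr0_norm lam0) ler_wpM2l ?(ltW lam0)//.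
  rewrite distrC ltW// Hd1//; first by rewrite kh0.
  exact: le_lt_trans (step _ _ ku).2 hd1.
rewrite sumr_const card_ord -mulrnAl -(mulr_natl h).
have mT : m%:R * h <= T by have /andP[] := kh m mn.
have le1 : 0 <= lam * e1 by rewrite mulr_ge0// ltW.
rewrite (le_trans (ler_wpM2r le1 mT))//.
have -> : T * (lam * e1) = e * (T / (T + 1)).
  by rewrite /e1; field; rewrite !gt_eqF// ltr_wpDl.
by rewrite ler_piMr ?(ltW e0)// ler_pdivrMr ?ltr_wpDl// mul1r lerDl.
Unshelve. all: by end_near. Qed.

(** If [l] is not hit before [T], the left side is at most 0 while [f] is nonnegative. Otherwise the
    stopping time does not exceed the hitting time [tau]: the discount is at least e^(-lam tau), and
    the path is then above [lev] on leg l_1, where [f] is at least [phi lev]. *)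
Lemma stopped_ge : 0 < T -> \forall n \near \oo, forall m, (m <= n)%N ->
    (forall j, (j < m)%N -> below lev (b (j%:R * (T / n%:R)))) ->
    ((m < n)%N -> ~~ below lev (b (m%:R * (T / n%:R)))) ->
    (nat_of_ord (b (m%:R * (T / n%:R))).1 = 0%N -> (b (m%:R * (T / n%:R))).2 <= l) ->
  phi lev * (hit_lap lam l b - expR (- (lam * T))) <=
    (1 + lam * (T / n%:R))^-1 ^+ m * ev f (b (m%:R * (T / n%:R))).
Proof.
move=> Tpos.
have yc := @continuous_leg_coord R N b b_ge0 b_cont o.
have lpos : 0 < l := le_lt_trans lev0 levl.
have ll : 0 < l - lev by rewrite subr_gt0.
have [d2 d20 Hd2] := uniformly_continuous_segment _ 0 T (l - lev) yc ll.
near=> n => m mn bm nbm bl.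
have n0 : (0 < n)%N by near: n; exists 1%N.
have hd2 : T / n%:R < d2 by near: n; exact: near_mesh_lt.
set h := T / n%:R in bm nbm bl hd2 *.
have h0 : 0 < h by rewrite divr_gt0// ltr0n.
have nh : n%:R * h = T by rewrite /h mulrCA divff ?mulr1// pnatr_eq0 -lt0n.
have q0 : 0 <= (1 + lam * h)^-1 ^+ m.
  by rewrite exprn_ge0// invr_ge0 addr_ge0// mulr_ge0// ltW.
have F0 : 0 <= ev f (b (m%:R * h)) by exact: exit_fun_ge0.
have small x : x <= expR (- (lam * T)) ->
    phi lev * (x - expR (- (lam * T))) <= (1 + lam * h)^-1 ^+ m * ev f (b (m%:R * h)).
  move=> xT; apply: (@le_trans _ _ 0); last by rewrite mulr_ge0.
  by rewrite mulr_ge0_le0 ?subr_le0// ltW// exit_profile_gt0.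
have [[tau [tau0 tauL hE _]]|[_ hE]] :=
  hit_lapP o o0 lam l lpos b b_ge0 b_cont; last by apply: small; rewrite hE expR_ge0.
have [Ttau|tauT] := leP T tau.
  by apply: small; rewrite hE ler_expR lerN2 ler_pM2l.
have [j /andP[jtau tauj]] := grid_floor h tau h0 tau0.
have jn : (j < n)%N.
  by rewrite -(ltr_nat R) -(ltr_pM2r h0) nh (le_lt_trans jtau).
(* The last grid time before [tau] is within one mesh of a point at height [l], hence above [lev]:
   stopping has occurred by then. *)
have mj : (m <= j)%N.
  rewrite leqNgt; apply/negP => /bm /below_leg_coord.
  have jh0 : 0 <= j%:R * h by rewrite mulr_ge0// ltW.
  have jT : 0 <= j%:R * h <= T by rewrite jh0 (le_trans jtau)// ltW.
  have := Hd2 (j%:R * h) tau jT.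
  rewrite (ger0_norm jh0) (ger0_norm tau0) tauL distrC ger0_norm ?subr_ge0//.
  have -> : tau - j%:R * h < d2.
    rewrite (lt_trans _ hd2)// ltrBlDl (lt_le_trans tauj)//.
    by rewrite -natr1 mulrDl mul1r.
  by move=> /(_ isT); rewrite distrC => /(le_lt_trans (ler_norm _)); lra.
have mh : m%:R * h <= tau by rewrite (le_trans _ jtau)// ler_pM2r// ler_nat.
have /nbm : (m < n)%N := leq_ltn_trans mj jn.
rewrite /below negb_or negbK -ltNge => /andP[/eqP bm0 levb].
rewrite hE mulrC; apply: (@le_trans _ _ (expR (- (lam * tau)) * phi lev)).
  rewrite ler_wpM2r// ?gerBl ?expR_ge0//.
  by rewrite ltW// exit_profile_gt0.
have lamh0 : 0 <= lam * h by rewrite mulr_ge0// ltW.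
have /andP[Hq _] := discount_bounds (lam * h) m lamh0.
apply: ler_pM; rewrite ?expR_ge0//.
- by rewrite ltW// exit_profile_gt0.
- by rewrite (le_trans _ Hq)// ler_expR lerN2 mulrCA ler_pM2l.
- by rewrite /ev /f exit_fun_profile ?bl// exit_profile_homo// ltW.
Unshelve. all: by end_near. Qed.

(** If [m = n], the stopping time is [T] and the value is at most about [C] e^(-lam T). If [m < n],
    the path is above [lev] on leg l_1, so it has already hit [lev]: the discount is then at most
    the hitting discount up to [e / C], and [f] is at most [phi l]. *)
Lemma stopped_le (C e : R) : 0 < lev -> phi l <= C ->
  (forall i x, 0 <= x -> `|f i x| <= C) -> 0 < e ->
  \forall n \near \oo, forall m, (m <= n)%N ->
    ((m < n)%N -> ~~ below lev (b (m%:R * (T / n%:R)))) ->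
    (nat_of_ord (b (m%:R * (T / n%:R))).1 = 0%N -> (b (m%:R * (T / n%:R))).2 <= l) ->
  (1 + lam * (T / n%:R))^-1 ^+ m * ev f (b (m%:R * (T / n%:R))) <=
    phi l * hit_lap lam lev b + C * expR (- (lam * T)) + e.
Proof.
move=> levpos phiC bC e0.
have C0 : 0 < C by rewrite (lt_le_trans _ phiC)// exit_profile_gt0.
(* The upper discount bound carries the factor e^(m (lam h)^2), whose exponent is at most lam^2 T^2
   / n. Keeping it below [ln (1 + e / C)] costs at most [e / C] in the discount. *)
have ln0 : 0 < ln (1 + e / C) by rewrite ln_gt0// ltrDl divr_gt0.
near=> n => m mn nbm bl.
have n0 : (0 < n)%N by near: n; exists 1%N.
have hsmall : (lam ^+ 2 * T * T) / n%:R < ln (1 + e / C).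
  by near: n; exact: near_mesh_lt.
set h := T / n%:R in nbm bl *.
have h0 : 0 <= h by rewrite divr_ge0.
have nh : n%:R * h = T by rewrite /h mulrCA divff ?mulr1// pnatr_eq0 -lt0n.
have mh0 : 0 <= m%:R * h by rewrite mulr_ge0.
have mhT : m%:R * h <= T by rewrite -nh ler_wpM2r// ler_nat.
have lamh0 : 0 <= lam * h by rewrite mulr_ge0// ltW.
have /andP[Hq0 Hq] := discount_bounds (lam * h) m lamh0.
have q0 : 0 <= (1 + lam * h)^-1 ^+ m := le_trans (expR_ge0 _) Hq0.
have {}Hq : (1 + lam * h)^-1 ^+ m <= expR (- (lam * (m%:R * h))) + e / C.
  rewrite (le_trans Hq)// [m%:R * (lam * h)]mulrCA.
  apply: (@le_trans _ _ (expR (- (lam * (m%:R * h))) * (1 + e / C))).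
    rewrite ler_wpM2l ?expR_ge0//.
    rewrite -[leRHS]lnK ?posrE ?addr_gt0 ?divr_gt0// ler_expR.
    rewrite (le_trans _ (ltW hsmall))//.
    have -> : m%:R * (lam * h) ^+ 2 = lam ^+ 2 * h * (m%:R * h) by ring.
    have -> : lam ^+ 2 * T * T / n%:R = lam ^+ 2 * h * T by rewrite /h; ring.
    by rewrite ler_wpM2l// mulr_ge0// exprn_ge0// ltW.
  have eC0 : 0 <= e / C by rewrite divr_ge0// ltW.
  rewrite mulrDr mulr1 lerD2l ler_piMl// -[leRHS]expR0 ler_expR oppr_le0.
  by rewrite mulr_ge0// ltW.
have CeC : C * (e / C) = e by rewrite mulrCA divff ?mulr1// gt_eqF.
have phi0 : 0 <= phi l by rewrite ltW// exit_profile_gt0.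
have /andP[hit0 _] := hit_lap_itv o o0 lam lev lam0 levpos b b_ge0 b_cont.
move: mn; rewrite leq_eqVlt => /orP[/eqP mE|mn].
  apply: (@le_trans _ _ ((expR (- (lam * T)) + e / C) * C)).
    have FC : ev f (b (m%:R * h)) <= C.
      by rewrite (le_trans (ler_norm _))//; exact: bC.
    rewrite (le_trans (ler_wpM2l q0 FC))// ler_wpM2r ?(ltW C0)//.
    by move: Hq; rewrite mE nh.
  rewrite mulrDl (mulrC _ C) (mulrC _ C) CeC lerD2r lerDr mulr_ge0//.
have := nbm mn; rewrite /below negb_or negbK -ltNge => /andP[/eqP bm0 levb].
have Fphi : ev f (b (m%:R * h)) <= phi l.
  by rewrite /ev /f exit_fun_profile ?bl// exit_profile_homo// bl.
have [t /andP[t0 tmh] tlev] := hit_before o lev levpos b b_ge0 b_cont b0 _ mh0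
  (eq_ind _ (fun x => lev <= x) (ltW levb) _ (leg0_leg_coord _ bm0)).
have hitm : expR (- (lam * (m%:R * h))) <= hit_lap lam lev b.
  have [[tau [_ _ -> taule]]|[nhit _]] :=
    hit_lapP o o0 lam lev levpos b b_ge0 b_cont; last by case: (nhit t t0).
  by rewrite ler_expR lerN2 ler_pM2l// (le_trans _ tmh)// taule.
apply: (@le_trans _ _ ((hit_lap lam lev b + e / C) * phi l)).
  apply: (le_trans (ler_wpM2l q0 Fphi)); rewrite ler_wpM2r//.
  by rewrite (le_trans Hq)// lerD2r.
rewrite mulrDl mulrC -addrA lerD2l.
apply: (@le_trans _ _ (e / C * C)).
  by rewrite ler_wpM2l// divr_ge0// ltW.
by rewrite mulrC CeC lerDr mulr_ge0 ?expR_ge0// ltW.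
Unshelve. all: by end_near. Qed.

End Path.
End ExitEstimates.

(** * Removal of the time horizon, and the geometric series *)

Lemma le_expRN_vanish {R : realType} (lam x y C : R) : 0 < lam -> 0 <= C ->
  (forall T, 0 < T -> x <= y + C * expR (- (lam * T))) -> x <= y.
Proof.
move=> lam0 C0 H; apply/ler_addgt0Pr => e e0.
(* At this [T], e^(lam T) >= 1 + lam T > C / e, so the error term is below [e]. *)
have T0 : 0 < C / e / lam + 1 by rewrite ltr_wpDl// !divr_ge0// ltW.
rewrite (le_trans (H _ T0))// lerD2l expRN.
rewrite ler_pdivrMr ?expR_gt0// mulrC -ler_pdivrMr//.
rewrite (le_trans _ (expR_ge1Dx _))//.
have -> : lam * (C / e / lam + 1) = C / e + lam by field; rewrite !gt_eqF.
by rewrite addrCA lerDl addr_ge0// ltW.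
Qed.

(** With q = e^(-g L), [exit_profile] at [L] equals (1 - r q^2)/q, so the quotient is the sum of a
    geometric series of first term (2/N) q and ratio r q^2 in [0, 1). *)
Lemma exit_series {R : realType} {N : nat} (L lam : R) :
  (2 <= N)%N -> 0 < L -> 0 < lam ->
  (\sum_(0 <= n <oo) ((2 / N%:R) * (1 - 2 / N%:R) ^+ n
        * expR (- ((2 * n + 1)%:R * Num.sqrt (2 * lam) * L)))%:E)%E =
  (2 / N%:R / @exit_profile R N lam L)%:E.
Proof.
move=> hN L0 lam0.
pose g := Num.sqrt (2 * lam); pose r : R := 1 - 2 / N%:R.
have g0 : 0 < g * L by rewrite mulr_gt0// sqrtr_gt0 mulr_gt0.
pose q := expR (- (g * L)).
have q1 : q ^+ 2 < 1 by rewrite exprn_ilt1// ?expR_ge0// -expR0 ltr_expR oppr_lt0.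
have r01 : 0 <= r < 1.
  rewrite /r subr_ge0 ler_pdivrMr ?ltr0n ?(ltnW hN)// mul1r ler_nat hN/=.
  by rewrite gtrBl divr_gt0// ltr0n ltnW.
have z1 : `|r * q ^+ 2| < 1.
  have /andP[r0 r1] := r01.
  rewrite ger0_norm ?mulr_ge0 ?exprn_ge0 ?expR_ge0//.
  by rewrite mulr_ilt1// ?exprn_ge0 ?expR_ge0.
have -> : 2 / N%:R / @exit_profile R N lam L = (2 / N%:R * q) / (1 - r * q ^+ 2).
  have -> : @exit_profile R N lam L = (1 - r * q ^+ 2) / q.
    have qV : expR (g * L) = q^-1 by rewrite /q expRN invrK.
    by rewrite /exit_profile -/g -/r -/q qV; field; rewrite gt_eqF// expR_gt0.
  by rewrite invfM invrK mulrA mulrAC.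
apply: cvg_lim => //.
have cvg_S := cvg_geometric_series (a := 2 / N%:R * q) z1.
have /(@cvg_EFin R nat \oo _ (fun n => (series (geometric (2 / N%:R * q) (r * q ^+ 2)) n)%:E))
  := cvg_S.
move=> /(_ (nearW _ (fun=> erefl))); apply: cvg_trans.
apply: near_eq_cvg; apply: nearW => n /=; rewrite sumEFin /series/=.
congr EFin; apply: eq_bigr => k _ /=.
rewrite -/g -/r exprMn -exprM /q -!expRM_natl.
have -> : - ((2 * k + 1)%:R * g * L) = - (g * L) + (2 * k)%:R * - (g * L).
  by rewrite natrD; ring.
by rewrite expRD; ring.
Qed.

(** * Two-sided bounds for the Laplace transform and their limits *)

Section Laplace.
Context {R : realType} {N : nat}.
Hypothesis hN : (2 <= N)%N.
Context {d : measure_display} {Omega : measurableType d}.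
Variables (P : probability Omega R) (b : R -> Omega -> 'I_N * R).
Hypothesis hb : spider_BM P b.
Variables (L lam : R).
Hypotheses (L0 : 0 < L) (lam0 : 0 < lam).

Local Notation phi := (@exit_profile R N lam).
Local Notation hit := (fun w => hit_lap lam L (b ^~ w)).

Let o : 'I_N := Ordinal (ltnW hN).
Let o0 : nat_of_ord o = 0%N. Proof. by []. Qed.
Let b_ge0 t w : 0 <= (b t w).2. Proof. by case: hb. Qed.
Let b_meas t i : measurable_fun setT (fun w => leg_coord i (b t w)).
Proof. by case: hb => _ [+ _]; apply. Qed.
Let b0 w : (b 0 w).2 = 0. Proof. by case: hb => _ [_ [+ _]]; apply. Qed.
Let b_cont w : spider_path_continuous (b ^~ w).
Proof. by case: hb => _ [_ [_ [+ _]]]; apply. Qed.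

Lemma measurable_hit : measurable_fun setT hit.
Proof. exact: (measurable_hit_lap o o0 lam L lam0 L0 b). Qed.

Lemma hit_bound w : `|hit w| <= 1.
Proof.
have /andP[? ?] := hit_lap_itv o o0 lam L lam0 L0 (b ^~ w) (b_ge0 ^~ w) (b_cont w).
by rewrite ger0_norm.
Qed.

Let measurable_affine (a c : R) : measurable_fun setT (fun w => a * hit w + c).
Proof. by apply: measurable_funD => //; apply: measurable_funM => //; exact: measurable_hit. Qed.

Let affine_bound (a c : R) w : `|a * hit w + c| <= `|a| + `|c|.
Proof.
rewrite (le_trans (ler_normD _ _))// lerD2r normrM ler_piMr//.
exact: hit_bound.
Qed.

Let Rintegral_affine (a c : R) :
  \int[P]_w (a * hit w + c) = a * \int[P]_w hit w + c.
Proof.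
have ih := bounded_measurable_integrable P _ _ measurable_hit hit_bound.
have iah : P.-integrable setT (EFin \o (fun w => a * hit w)).
  apply: (bounded_measurable_integrable P _ `|a|).
    by apply: measurable_funM => //; exact: measurable_hit.
  by move=> w; rewrite normrM ler_piMr//; exact: hit_bound.
have ic : P.-integrable setT (EFin \o cst c).
  by apply: (bounded_measurable_integrable P _ `|c|) => //; exact: measurable_cst.
rewrite RintegralD// RintegralZl// Rintegral_cst//.
by congr (_ + _); rewrite -[RHS]mulr1; congr (_ * _); exact: (congr1 fine (probability_setT P)).
Qed.

Let ev_start l w : 0 <= l -> ev (exit_fun lam l) (b 0 w) = 2 / N%:R.
Proof. by move=> l0; rewrite /ev b0 exit_fun_vertex. Qed.

Let killed_sum_approx lev l T w e : 0 <= lev -> lev < l -> 0 < T -> 0 < e ->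
  \forall n \near \oo, exists m, [/\ (m <= n)%N,
    forall j, (j < m)%N -> below lev (b (j%:R * (T / n%:R)) w),
    (m < n)%N -> ~~ below lev (b (m%:R * (T / n%:R)) w),
    (nat_of_ord (b (m%:R * (T / n%:R)) w).1 = 0%N ->
       (b (m%:R * (T / n%:R)) w).2 <= l) &
    `|killed_sum b (exit_fun lam l) lam lev T n w -
      ((1 + lam * (T / n%:R))^-1 ^+ m *
        ev (exit_fun lam l) (b (m%:R * (T / n%:R)) w) - 2 / N%:R)| <= e].
Proof.
move=> lev0 levl T0 e0; have l0 := le_trans lev0 (ltW levl).
apply: filterS (drift_error hN o o0 lam lam0 (b ^~ w) (b_ge0 ^~ w) (b_cont w)
  (b0 w) lev l T lev0 levl (ltW T0) e e0) => n H.
have [m [mn bm nbm E]] :=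
  killed_sum_stopped b (exit_fun lam l) lam lev T lam0 (ltW T0) n w.
have [bl Hm] := H m mn bm.
by exists m; split=> //; rewrite E ev_start// addrC addKr.
Qed.

(** The exit function is continued beyond [L] and the walk on the grid is stopped above [lev < L].
    Up to [e], the stopped value minus 2/N is a centred killed sum, and [stopped_ge] bounds it from
    below. *)
Lemma hit_le_exit (lev T : R) : 0 < lev -> lev < L -> 0 < T ->
  phi lev * (\int[P]_w hit w - expR (- (lam * T))) <= 2 / N%:R.
Proof.
move=> lev0 levL T0.
have hf := exit_fun_gen_dom hN lam L lam0 (ltW L0).
have kc n := killed_sum_centred P b hb _ hf o lam lev T (ltW lev0) (ltW T0) n.
have [C bC] := killed_sum_bound P b hb _ hf o lam lev T lam0 (ltW T0).
pose c := - (phi lev * expR (- (lam * T))) - 2 / N%:R.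
rewrite -subr_le0.
have -> : phi lev * (\int[P]_w hit w - expR (- (lam * T))) - 2 / N%:R =
    \int[P]_w (phi lev * hit w + c) by rewrite Rintegral_affine /c; ring.
apply: (Rintegral_le0_liminf P _ _ C _ (fun n => (let: And3 m _ _ := kc n in m))
  bC (fun n => (let: And3 _ _ m := kc n in m)) (measurable_affine _ _)
  (affine_bound _ _)) => w e e0.
apply: filterS2 (killed_sum_approx lev L T w e (ltW lev0) levL T0 e0)
  (stopped_ge hN o o0 lam lam0 (b ^~ w) (b_ge0 ^~ w) (b_cont w)
    lev L T (ltW lev0) levL T0) => n [m [mn bm nbm bl Hm]] H.
have := H m mn bm nbm bl.
by move: Hm; rewrite ler_norml => /andP[]; rewrite /c; lra.
Qed.

(** Now stopping takes place above [L] and the continuation starts at [l > L]. The constant is fixed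
    before [T], so that [T] can tend to infinity with [l] fixed. *)
Lemma exit_le_hit (l : R) : L < l -> exists2 C : R, 0 <= C & forall T, 0 < T ->
  2 / N%:R <= phi l * \int[P]_w hit w + C * expR (- (lam * T)).
Proof.
move=> Ll; have l0 : 0 <= l := le_trans (ltW L0) (ltW Ll).
have hf := exit_fun_gen_dom hN lam l lam0 l0.
have [C [Cphi bC]] : exists C, phi l <= C /\
    forall (i : 'I_N) x, 0 <= x -> `|exit_fun lam l i x| <= C.
  have [_ [_ [_ [_ [[M bM] _]]]]] := hf.
  exists M; split; last by move=> i x /(bM i)[].
  rewrite -(exit_fun_profile lam l o l)//.
  by rewrite (le_trans (ler_norm _))//; have [] := bM o l l0.
exists C; first by rewrite (le_trans _ Cphi)// ltW// exit_profile_gt0.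
move=> T T0.
have kc n := killed_sum_centred P b hb _ hf o lam L T (ltW L0) (ltW T0) n.
have [D bD] := killed_sum_bound P b hb _ hf o lam L T lam0 (ltW T0).
pose c := 2 / N%:R - C * expR (- (lam * T)).
rewrite -subr_le0.
have -> : 2 / N%:R - (phi l * \int[P]_w hit w + C * expR (- (lam * T))) =
    \int[P]_w (- phi l * hit w + c) by rewrite Rintegral_affine /c; ring.
(* The killed sum is negated, because here it has to be bounded from above. *)
apply: (Rintegral_le0_liminf P (fun n w => - killed_sum b (exit_fun lam l) lam L T n w)
  _ D _ _ _ _ (measurable_affine _ _) (affine_bound _ _)) => [n|n w|n|w e e0].
- by have [mk _ _] := kc n; exact: measurable_funN.
- by rewrite normrN.
- have [mk _ Ek] := kc n.
  under eq_Rintegral do rewrite -mulN1r.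
  rewrite RintegralZl// ?Ek ?mulr0//.
  exact: bounded_measurable_integrable mk (bD n).
have e20 : 0 < e / 2 by rewrite divr_gt0.
apply: filterS2 (killed_sum_approx L l T w _ (ltW L0) Ll T0 e20)
  (stopped_le hN o o0 lam lam0 (b ^~ w) (b_ge0 ^~ w) (b_cont w) (b0 w)
    L l T (ltW L0) Ll (ltW T0) C _ L0 Cphi bC e20) => n [m [mn bm nbm bl Hm]] H.
have := H m mn nbm bl.
by move: Hm; rewrite ler_norml => /andP[]; rewrite /c; lra.
Qed.

(** For a fixed level [x], first let [T] tend to infinity; then let [x] tend to [L] from the left
    for the upper bound and from the right for the lower bound, using continuity of [phi]. *)
Lemma Rintegral_hit : phi L * \int[P]_w hit w = 2 / N%:R.
Proof.
have phic := @continuous_exit_profile R N lam.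
have E0 : 0 <= \int[P]_w hit w.
  apply: Rintegral_ge0 => w _.
  by have /andP[] := hit_lap_itv o o0 lam L lam0 L0 (b ^~ w) (b_ge0 ^~ w) (b_cont w).
apply/eqP; rewrite eq_le; apply/andP; split.
  apply: (@ler_cvg_to _ (L^'-) _ _ (fun x => phi x * \int[P]_w hit w) (fun=> 2 / N%:R)).
  - by apply: cvgM; [apply: cvg_at_left_filter; exact: phic|exact: cvg_cst].
  - exact: cvg_cst.
  - near=> x.
    have x0 : 0 < x by near: x; exact: nbhs_left_gt.
    have xL : x < L by near: x; exact: nbhs_left_lt.
    apply: (le_expRN_vanish lam _ _ (phi x)) => //; first by rewrite ltW// exit_profile_gt0// ltW.
    by move=> T /(hit_le_exit x T x0 xL); rewrite mulrBr lerBlDr.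
apply: (@ler_cvg_to _ (L^'+) _ _ (fun=> 2 / N%:R) (fun x => phi x * \int[P]_w hit w)).
- exact: cvg_cst.
- by apply: cvgM; [apply: cvg_at_right_filter; exact: phic|exact: cvg_cst].
- near=> x.
  have Lx : L < x by near: x; exact: nbhs_right_gt.
  by have [C C0 H] := exit_le_hit x Lx; exact: le_expRN_vanish lam0 C0 H.
Unshelve. all: by end_near. Qed.

End Laplace.

Theorem theorem2p4 (R : realType) (N : nat) (hN : (2 <= N)%N)
  (d : measure_display) (Omega : measurableType d) (P : probability Omega R)
  (b : R -> Omega -> 'I_N * R) (hb : spider_BM P b)
  (L : R) (hL : 0 < L) (lam : R) (hlam : 0 < lam) :
  (\int[P]_w (hit_lap lam L (fun t => b t w))%:E =
   \sum_(0 <= n <oo)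
     ((2 / N%:R) * (1 - 2 / N%:R) ^+ n
        * expR (- ((2 * n + 1)%:R * Num.sqrt (2 * lam) * L)))%:E)%E.
Proof.
rewrite exit_series//.
have H := Rintegral_hit hN P b hb L lam hL hlam.
have ih := bounded_measurable_integrable P _ _ (measurable_hit hN P b hb L lam hL hlam)
  (hit_bound hN P b hb L lam hL hlam).
rewrite -[LHS]fineK; last exact: integrable_fin_num ih.
have phi0 : @exit_profile R N lam L != 0.
  by rewrite gt_eqF// exit_profile_gt0// ltW.
by congr EFin; apply: (mulfI phi0); rewrite H mulrCA divff ?mulr1.
Qed.
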